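(* Let $X$ be a locally compact Hausdorff connected space, and suppose that either (A) $\rho$ is a quasi-linear functional on $C_0(X)$ with $\|\rho\|<\infty$, or (B) $\rho$ is a quasi-linear functional on $C_c(X)$. Then there exists a unique topological measure $\mu$ on $X$ such that $\rho=\rho_\mu$. In fact, $\mu=\mu_\rho$. In case (A) $\mu$ is finite with $\mu(X)=\|\rho\|$, and in case (B) $\mu$ is compact-finite.
   Context: $C_0(X)$, $C_c(X)$, $C_b(X)$ are the real-valued continuous functions on $X$ vanishing at infinity, with compact support, and bounded, respectively, with the uniform norm (all equal to $C(X)$ if $X$ is compact); $\operatorname{supp} f=\overline{\{f\neq0\}}$. Singly generated subalgebra: for $f\in C_b(X)$, $S(f)$ is the smallest uniformly closed subalgebra of $C_b(X)$ containing $f$ and, if $X$ is compact, also containing the constant $1$. (If $X$ is compact, $S(f)=\{\phi\circ f:\phi\in C(f(X))\}$; if $X$ is not compact and $f\in C_0(X)$ or $C_c(X)$, $S(f)=\{\phi\circ f:\phi\in C(\overline{f(X)}),\ \phi(0)=0\}$, which lies in $C_0(X)$, resp. $C_c(X)$.) Quasi-linear functional on $\mathcal B$ ($\mathcal B=C_0(X)$ or $C_c(X)$): a map $\rho:\mathcal B\to\mathbb R$ with $\rho(af)=a\rho(f)$ for $a\in\mathbb R$, $f\in\mathcal B$; $\rho(f+g)=\rho(f)+\rho(g)$ whenever $f,g\in S(h)$ for some $h\in\mathcal B$; and $\rho(f)\ge0$ whenever $f\ge0$. Its norm is $\|\rho\|=\sup\{\rho(f): f\in\mathcal B,\ 0\le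 f\le1\}\in[0,\infty]$. Topological measure on $X$: a set function $\mu$ from the open and closed subsets of $X$ to $[0,\infty]$, not identically $\infty$, such that (TM1) $\mu(A\sqcup B)=\mu(A)+\mu(B)$ whenever $A,B$ are disjoint and each of $A,B,A\sqcup B$ is compact or open; (TM2) $\mu(U)=\sup\{\mu(K):K\subseteq U \text{ compact}\}$ for $U$ open; (TM3) $\mu(F)=\inf\{\mu(U):U\supseteq F\text{ open}\}$ for $F$ closed. It is finite if $\mu(X)<\infty$, and compact-finite if $\mu(K)<\infty$ for all compact $K$. Functional $\rho_\mu$: it is defined on $C_0(X)$ if $\mu$ is finite (case (A)), and on $C_c(X)$ if $\mu$ is compact-finite (case (B)), by $\rho_\mu(f)=\int_{\mathbb R}t\,dm_f(t)$, where $m_f$ is the Stieltjes measure on $\mathbb R$ with $m_f((s,t])=F(s)-F(t)$ for $s<t$, and $F(a)=\mu(f^{-1}((a,\infty)))$ in case (A), $F(a)=\mu(f^{-1}((a,\infty)\setminus\{0\}))$ in case (B). (If both cases apply to $f$ they give the same value.) Set function $\mu_\rho$: $\mu_\rho(U)=\sup\{\rho(f): f\in C_c(X),\ 0\le f\le1,\ \operatorname{supp} f\subseteq U\}$ for $U$ open, and $\mu_\rho(F)=\inf\{\mu_\rho(U):F\subseteq U,\ U\text{ open}\}$ for $F$ closed. *)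

(* Defs.v *)
From HB Require Import structures.
From mathcomp Require Import all_boot all_order all_algebra.
From mathcomp Require Import all_classical all_reals all_analysis.

Set Implicit Arguments.
Unset Strict Implicit.
Unset Printing Implicit Defensive.

Import Order.TTheory GRing.Theory Num.Theory.
Import numFieldNormedType.Exports.

Local Open Scope classical_set_scope.
Local Open Scope ring_scope.

Section function_spaces.
Context {R : realType} {X : topologicalType}.
Implicit Types (f g h : X -> R) (S B : set (X -> R)) (rho : (X -> R) -> R).

Definition supp f : set X := closure [set x | f x != 0].

Definition C_b : set (X -> R) := [set f | continuous f /\ bounded_fun f].

Definition C_c : set (X -> R) := [set f | continuous f /\ compact (supp f)].

Definition C_0 : set (X -> R) :=
  [set f | continuous f /\ forall e, 0 < e -> compact [set x | e <= `|f x|]].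

(* Closedness is taken in the space of all functions X -> R with uniform
   convergence; as C_b is closed there, it is the same as closedness in C_b. *)
Definition closed_subalgebra S : Prop :=
  [/\ S `<=` C_b,
      S 0,
      forall a f, S f -> S (a *: f),
      forall f g, S f -> S g -> S (f + g) /\ S (f * g)
    & closed (S : set {uniform X -> R})].

Definition singly_generated f : set (X -> R) :=
  smallest [set S | closed_subalgebra S /\ (compact [set: X] -> S (cst 1))]
           [set f].

(* A functional on B is represented by a map on all of X -> R of which only
   the values on B are relevant. *)
Definition quasi_linear B rho : Prop :=
  [/\ forall a f, B f -> rho (a *: f) = a * rho f,
      forall f g h, B f -> B g -> B h ->
        singly_generated h f -> singly_generated h g ->
        rho (f + g) = rho f + rho g
    & forall f, B f -> (forall x, 0 <= f x) -> 0 <= rho f].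

Definition ql_norm B rho : \bar R :=
  ereal_sup [set (rho f)%:E | f in
    [set f | B f /\ forall x, 0 <= f x <= 1]].

End function_spaces.

Section topological_measures.
Context {R : realType} {X : topologicalType}.
Implicit Types (f : X -> R) (mu nu : set X -> \bar R) (A B K U F : set X).
Local Open Scope ereal_scope.

(* A set function on the open and the closed subsets of X is represented by a
   map on all subsets, of which only the values on those are relevant. *)
Definition open_or_closed A : Prop := open A \/ closed A.

Definition eq_open_closed mu nu : Prop :=
  forall A, open_or_closed A -> mu A = nu A.

Let compact_or_open A : Prop := compact A \/ open A.

Definition topological_measure mu : Prop :=
  [/\ forall A, open_or_closed A -> 0 <= mu A,
      exists2 A, open_or_closed A & mu A != +oo,
      forall A B, A `&` B = set0 ->
        compact_or_open A -> compact_or_open B -> compact_or_open (A `|` B) ->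
        mu (A `|` B) = mu A + mu B,
      forall U, open U ->
        mu U = ereal_sup [set mu K | K in [set K | compact K /\ K `<=` U]]
    & forall F, closed F ->
        mu F = ereal_inf [set mu U | U in [set U | open U /\ F `<=` U]]].

Definition finite_tm mu : Prop := mu [set: X] < +oo.

Definition compact_finite_tm mu : Prop := forall K, compact K -> mu K < +oo.

Definition tail_C0 mu f (a : R) : \bar R := mu (f @^-1` `]a, +oo[).

Definition tail_Cc mu f (a : R) : \bar R := mu (f @^-1` (`]a, +oo[ `\ 0%R)).

End topological_measures.

Section stieltjes.
Context {R : realType}.
Implicit Types F : R -> \bar R.

Definition decumulative F : Prop :=
  [/\ forall a, F a \is a fin_num,
      {homo (fun a => - fine (F a)) : a b / a <= b}
    & right_continuous (fun a : R => - fine (F a) : R)].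

Definition cumulative_of F (dF : decumulative F) : cumulative R R :=
  let: And3 _ ndF rcF := dF in
  HB.pack (fun a => - fine (F a))
    (isCumulative.Build R _ R (fun a => - fine (F a)) ndF rcF).

(* The Stieltjes measure giving mass F s - F t to ]s, t] (see stieltjesE). The
   second branch is not used: decumulative_tail_C0 and decumulative_tail_Cc. *)
Definition stieltjes F : set (measurableTypeR R) -> \bar R :=
  match pselect (decumulative F) with
  | left dF => lebesgue_stieltjes_measure (cumulative_of dF)
  | right _ => mzero
  end.

Lemma stieltjesE F (s t : R) : decumulative F -> s < t ->
  stieltjes F `]s, t]%classic = (F s - F t)%E.
Proof.
move=> dF st.
have lsE (G : cumulative R R) :
    lebesgue_stieltjes_measure G `]s, t]%classic = (G t - G s)%:E.
  rewrite /lebesgue_stieltjes_measure /measure_extension/=.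
  rewrite measurable_mu_extE/=; last exact: is_ocitv.
  by rewrite wlength_itv_bnd// ltW.
rewrite /stieltjes; case: pselect => // dF'; rewrite lsE.
case: dF' => fF ndF rcF /=.
by rewrite opprK addrC EFinB !fineK.
Qed.

End stieltjes.

Section functionals.
Context {R : realType} {X : topologicalType}.
Implicit Types (f : X -> R) (mu : set X -> \bar R) (rho : (X -> R) -> R).
Local Open Scope ereal_scope.

Definition rho_C0 mu f : \bar R := \int[stieltjes (tail_C0 mu f)]_t t%:E.

Definition rho_Cc mu f : \bar R := \int[stieltjes (tail_Cc mu f)]_t t%:E.

Definition mu_open rho (U : set X) : \bar R :=
  ereal_sup [set (rho f)%:E | f in
    [set f | [/\ C_c f, forall x, (0 <= f x <= 1)%R & supp f `<=` U]]].

(* On clopen sets the two formulas agree, mu_open rho being monotone. *)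
Definition mu_of rho (A : set X) : \bar R :=
  if `[< open A >] then mu_open rho A
  else ereal_inf [set mu_open rho U | U in [set U | open U /\ A `<=` U]].

End functionals.

Section well_definedness.
Context {R : realType} {X : topologicalType} (mu : set X -> \bar R)
  (tm_mu : topological_measure mu).
Implicit Types (f : X -> R) (U V K : set X).
Local Open Scope ereal_scope.

Lemma tm_le_compact_open K U : compact K -> open U -> K `<=` U -> mu K <= mu U.
Proof.
case: tm_mu => _ _ _ tm2 _ cK oU KU; rewrite (tm2 U)//.
by apply: ereal_sup_ubound; exists K.
Qed.

Lemma tm_le_open U V : open U -> open V -> U `<=` V -> mu U <= mu V.
Proof.
case: (tm_mu) => _ _ _ tm2 _ oU oV UV; rewrite (tm2 U)//.
apply: ge_ereal_sup => _ [K [cK KU] <-].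
by apply: tm_le_compact_open => //; exact: subset_trans UV.
Qed.

Lemma tm_le_open_closed U K : open U -> closed K -> U `<=` K -> mu U <= mu K.
Proof.
case: (tm_mu) => _ _ _ _ tm3 oU cK UK; rewrite (tm3 K)//.
apply: le_ereal_inf_tmp => _ [V [oV KV] <-].
by apply: tm_le_open => //; exact: subset_trans KV.
Qed.

Lemma decumulative_tail f (D : set X) : continuous f -> open D ->
  (forall a, mu ((f @^-1` `]a, +oo[) `&` D) < +oo) ->
  decumulative (fun a => mu ((f @^-1` `]a, +oo[) `&` D)).
Proof.
move=> cf oD fin.
set F := fun a : R => mu ((f @^-1` `]a, +oo[) `&` D).
have oE (a : R) : open ((f @^-1` `]a, +oo[) `&` D).
  by apply: openI => //; apply: open_comp => // x _; exact: cf.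
have fF a : F a \is a fin_num.
  rewrite ge0_fin_numE; first exact: fin.
  by case: tm_mu => mu0 _ _ _ _; apply: mu0; left; exact: oE.
have Fle (a b : R) : (a <= b)%R -> F b <= F a.
  move=> ab; apply: tm_le_open => //; apply: setSI; apply: preimage_subset.
  by apply: subset_itvr; rewrite bnd_simp.
split => //.
  by move=> a b ab; rewrite lerN2 fine_le// Fle.
move=> a; apply: cvgN; apply/cvgrPdist_lt => e e0.
have [_ [K [cK KE] <-]] : exists2 x, [set mu K | K in
    [set K | compact K /\ K `<=` (f @^-1` `]a, +oo[) `&` D]] x &
    ereal_sup [set mu K | K in
    [set K | compact K /\ K `<=` (f @^-1` `]a, +oo[) `&` D]] - e%:E < x.
  apply: ub_ereal_sup_adherent => //.
  by case: tm_mu => _ _ _ tm2 _; rewrite -tm2//; exact: fF.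
case: (tm_mu) => _ _ _ tm2 _; rewrite -tm2// -/(F a) => FaK.
have [b ab Kb] : exists2 b : R, (a < b)%R &
    K `<=` (f @^-1` `]b, +oo[) `&` D.
  have [->|/set0P K0] := eqVneq K set0; first by exists (a + 1)%R; rewrite ?ltrDl.
  have [c] := compact_EVT_min K0 cK (continuous_subspaceT cf).
  rewrite inE => Kc cmin; have [/= + _] := KE _ Kc.
  rewrite in_itv/= andbT => afc.
  exists ((a + f c) / 2)%R; first by rewrite midf_lt.
  move=> x Kx; have [_ Dx] := KE _ Kx; split => //=.
  rewrite in_itv/= andbT (@lt_le_trans _ _ (f c))//; first by rewrite midf_lt.
  by rewrite cmin// inE.
near=> t.
have at_ : (a < t)%R by near: t; exact: nbhs_right_gt.
have tb : (t < b)%R by near: t; exact: nbhs_right_lt.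
rewrite ger0_norm; last by rewrite subr_ge0 fine_le// Fle// ltW.
rewrite ltrBlDr -ltrBlDl -lte_fin EFinB !fineK//.
rewrite (lt_le_trans FaK)//; apply: le_trans (Fle _ _ (ltW tb)).
exact: tm_le_compact_open.
Unshelve. all: by end_near. Qed.

Lemma decumulative_tail_C0 f : finite_tm mu -> C_0 f ->
  decumulative (tail_C0 mu f).
Proof.
move=> fin [cf _].
have -> : tail_C0 mu f = fun a => mu ((f @^-1` `]a, +oo[) `&` setT).
  by apply/funext => a; rewrite setIT.
apply: decumulative_tail => // [|a]; first exact: openT.
rewrite setIT; apply: le_lt_trans fin; apply: tm_le_open => //.
- by apply: open_comp => // x _; exact: cf.
- exact: openT.
Qed.

Lemma decumulative_tail_Cc f : hausdorff_space X -> compact_finite_tm mu ->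
  C_c f -> decumulative (tail_Cc mu f).
Proof.
move=> hX fin [cf cs].
have -> : tail_Cc mu f =
    fun a => mu ((f @^-1` `]a, +oo[) `&` [set x | (f x != 0)%R]).
  apply/funext => a; congr mu; apply/seteqP; split => x [/= fx /eqP fx0];
  by split => //; exact/eqP.
have oD : open [set x | (f x != 0)%R].
  by apply: (@open_comp _ _ f [set y | (y != 0)%R]) => [x _|];
    [exact: cf|exact: open_neq].
apply: decumulative_tail => // a; apply: le_lt_trans (fin _ cs).
apply: tm_le_open_closed.
- by apply: openI => //; apply: open_comp => // x _; exact: cf.
- exact: closed_closure.
- by move=> x [_ fx0]; exact: subset_closure.
Qed.

End well_definedness.

(* Main.v *)
(* For f in B (B = C_0 or C_c), rho is a positive linear functional on the
   functions phi o f with phi(0) = 0, so rho(f) is squeezed between layer-cake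
   sums: rho(min(g, b)) - rho(min(g, a)) lies between (b - a) mu{g >= b} and
   (b - a) mu{g > a}, where mu = mu_rho and g is the positive or the negative
   part of f.  The truncated integrals against the Stieltjes measure m_f satisfy
   the same bounds, which determine the value: two functions of the truncation
   level obeying them differ by less than the mesh of any partition times a
   constant.
   The additivity of mu_rho and the monotonicity of rho only use pairs of
   functions that lie in one singly generated subalgebra: if f >= 0 lives where
   r = 1, then r = min(f + r, 1) and f = (f + r) - r are both in S(f + r); if
   f g = 0, then f and g are the positive and negative parts of f - g. *)

Require Import Defs.
From mathcomp Require Import all_boot all_order all_algebra.
From mathcomp Require Import all_classical all_reals all_analysis.
From mathcomp Require Import measurable_realfun ring lra.
Set Implicit Arguments.
Unset Strict Implicit.
Unset Printing Implicit Defensive.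
Import Order.TTheory GRing.Theory Num.Theory.
Import numFieldNormedType.Exports.
Local Open Scope classical_set_scope.
Local Open Scope ring_scope.

(** * Closed subalgebras *)

(** Values of [rho] on two functions can be compared only once both are known to lie in one
    [singly_generated h]. Here all such memberships come from linear combinations and truncations
    [min (u, b)] with [b >= 0]; the positive part, for instance, is [u - min (u, 0)]. Approximating
    the absolute value by polynomials is therefore enough. The polynomials must vanish at 0, because
    the algebra need not contain the constants. Both cases share one argument. [B] is any space
    between [C_c] and [C_0] closed under domination, and tails are measured inside an open set [D],
    which is [X] in case (A) and [{f <> 0}] in case (B). One obstacle remains: a function [r] of [B]
    with values in [0, 1] need not compete in the supremum defining [mu_rho {r > 0}], since its
    support may leave that set or fail to be compact. A bound for [rho] on the functions that live
    where [r] does makes the low part [min (r, d)] negligible as [d] tends to 0. *)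

(* The iteration p' = p + (X^2 - p^2) / 2 increases to |y| on [-1, 1]; the
   error e_n satisfies e_n (2 + n |y|) <= 2 |y|. *)
Lemma norm_poly_approx {R : realType} (e : R) : 0 < e ->
  exists p : {poly R}, forall y, `|y| <= 1 -> `| `|y| - p.[y] | <= e.
Proof.
move=> e0.
pose P n : {poly R} := iter n (fun p => p + 2^-1 *: ('X^2 - p ^+ 2)) 0.
have PE n y : (P n.+1).[y] = (P n).[y] + 2^-1 * (`|y| ^+ 2 - (P n).[y] ^+ 2).
  by rewrite /P /= !hornerE real_normK ?num_real.
have key n y : `|y| <= 1 -> 0 <= (P n).[y] <= `|y| /\
    (`|y| - (P n).[y]) * (2 + n%:R * `|y|) <= 2 * `|y|.
  move=> y1; have := normr_ge0 y; move: (`|y|) y1 (PE ^~ y) => z z1 {}PE z0.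
  elim: n => [|n [/andP[p0 pz] IH]].
    by rewrite /P /= horner0 lexx z0 /=; split=> //; lra.
  rewrite PE; move: (P n).[y] p0 pz IH => p p0 pz IH; split.
    by apply/andP; split; nra.
  have n0 : 0 <= n%:R :> R by [].
  rewrite -(natr1 n); move: (n%:R : R) n0 IH => m m0 IH.
  apply: le_trans IH.
  (* One iteration multiplies the error by [1 - (z + p) / 2 <= 1 - z / 2], and [(1 - z / 2) (2 + (m
     + 1) z) = 2 + m z - (m + 1) z^2 / 2], which is at most [2 + m z]. *)
  have -> : z - (p + 2^-1 * (z ^+ 2 - p ^+ 2)) = (z - p) * (1 - (z + p) / 2).
    by field.
  rewrite -mulrA; apply: ler_wpM2l; first lra.
  have h1 : 1 - (z + p) / 2 <= 1 - z / 2 by lra.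
  apply: le_trans (_ : (1 - z / 2) * (2 + (m + 1) * z) <= _).
    by rewrite ler_wpM2r//; nra.
  have : 0 <= (m + 1) * z ^+ 2 by apply: mulr_ge0; [lra|exact: sqr_ge0].
  by rewrite expr2; nra.
(* An error above [e] would give [e (2 + n z) <= 2 z] with [z > 0], hence [n e < 2]. *)
pose n := (Num.truncn (2 / e)).+1.
have ne : 2 < n%:R * e by rewrite -ltr_pdivrMr// truncnS_gt.
exists (P n) => y y1; have [/andP[p0 pz] h] := key n y y1.
rewrite ger0_norm ?subr_ge0//.
move: (normr_ge0 y) (P n).[y] p0 pz h y1 => + p p0 pz h y1.
move: (`|y|) (n%:R : R) ne pz h y1 => z m me pz h y1 z0.
rewrite leNgt; apply/negP => ez.
have zp : 0 < z by lra.
have : e * (2 + m * z) <= 2 * z.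
  apply: le_trans h; rewrite ler_wpM2r ?(ltW ez)//.
  by apply: addr_ge0 => //; apply: mulr_ge0 => //; nra.
have : 2 * z < m * e * z by rewrite ltr_pM2r.
by nra.
Qed.

(** [min (t, b) = (t + b - |t - b|) / 2], and dividing by [K] brings [t - b] into [-1, 1]. Since
    [min (0, b) = 0], removing the constant term of [q] at most doubles its error; hence the bound
    [e / 2] for [q]. *)
Lemma min_poly_approx {R : realType} (M b e : R) : 0 <= b -> 0 < e ->
  exists2 p : {poly R}, p.[0] = 0 &
    forall t, `|t| <= M -> `|Num.min t b - p.[t]| <= e.
Proof.
move=> b0 e0; have [M0|M0] := leP 0 M; last first.
  by exists 0; rewrite ?horner0// => t tM; have := normr_ge0 t; lra.
pose K := M + b + 1; have K0 : 0 < K by rewrite /K; lra.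
have [p hp] := @norm_poly_approx R (e / K) (divr_gt0 e0 K0).
pose q := 2^-1 *: ('X + b%:P - K *: (p \Po (K^-1 *: ('X - b%:P)))).
have hq t : `|t| <= M -> `|Num.min t b - q.[t]| <= e / 2.
  move=> tM; have y1 : `|K^-1 * (t - b)| <= 1.
    rewrite normrM gtr0_norm ?invr_gt0// ler_pdivrMl// mulr1.
    by rewrite (le_trans (ler_normB _ _))// (ger0_norm b0) /K; lra.
  have -> : Num.min t b - q.[t] =
      - (K / 2) * (`|K^-1 * (t - b)| - p.[K^-1 * (t - b)]).
    rewrite /q !hornerE horner_comp !hornerE minr_absE normrM.
    rewrite (gtr0_norm (x:=K^-1)) ?invr_gt0//.
    by field; rewrite gt_eqF.
  rewrite normrM normrN (gtr0_norm (x:=K / 2)) ?divr_gt0//.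
  rewrite (le_trans (ler_wpM2l _ (hp _ y1))) ?divr_ge0 ?(ltW K0)//.
  by rewrite le_eqVlt; apply/orP; left; apply/eqP; field; rewrite gt_eqF.
exists (q - q.[0]%:P); first by rewrite !hornerE subrr.
move=> t tM; rewrite hornerD hornerN hornerC opprD opprK addrA.
rewrite (le_trans (ler_normD _ _))//.
have := hq t tM; have := hq 0; rewrite normr0 => /(_ M0).
by rewrite min_l// sub0r normrN; lra.
Qed.

Section closed_subalgebras.
Context {R : realType} {X : topologicalType}.
Implicit Types (u v h : X -> R) (S : set (X -> R)).

Lemma closed_uniform_approx S v : closed (S : set {uniform X -> R}) ->
  (forall e, 0 < e -> exists2 w, S w & forall x, `|v x - w x| <= e) -> S v.
Proof.
move=> cS Sv; apply: cS => A /uniform_nbhs[E [/= entE EA]].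
move: entE; rewrite -entourage_ballE => -[e /= e0 eE].
have e20 : 0 < e / 2 by rewrite divr_gt0.
have [w Sw vw] := Sv _ e20.
exists w; split => //; apply: EA => x _; apply: eE => /=.
by rewrite /ball/= (le_lt_trans (vw x))//; lra.
Qed.

Lemma closed_subalgebra_horner S u (p : {poly R}) : closed_subalgebra S ->
  S u -> p.[0] = 0 -> S (fun x => p.[u x]).
Proof.
move=> [_ S0 SZ SDM _] Su p0.
have Sn n : S (fun x => u x ^+ n.+1).
  elim: n => [|n IH]; first by under eq_fun do rewrite expr1.
  by under eq_fun do rewrite exprS; exact: (SDM _ _ Su IH).2.
have -> : (fun x => p.[u x]) = (fun x => \sum_(i < size p) p`_i * u x ^+ i).
  by apply/funext => x; rewrite horner_coef.
elim: (size p) => [|n IH].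
  by under eq_fun do rewrite big_ord0; exact: S0.
under eq_fun do rewrite big_ord_recr/=.
apply: (SDM _ _ IH _).1; case: n {IH} => [|n]; last exact: SZ.
by rewrite -horner_coef0 p0; under eq_fun do rewrite mul0r; exact: S0.
Qed.

Lemma closed_subalgebra_min S u (b : R) : closed_subalgebra S -> 0 <= b ->
  S u -> S (fun x => Num.min (u x) b).
Proof.
move=> SA b0 Su; have [SCb _ _ _ cS] := SA.
have [_ [M [_ /(_ (M + 1))uM]]] := SCb _ Su.
apply: closed_uniform_approx cS _ => e e0.
have [p p0 hp] := @min_poly_approx R (M + 1) b e b0 e0.
exists (fun x => p.[u x]); first exact: closed_subalgebra_horner.
by move=> x; apply: hp; apply: uM => //; rewrite ltrDl.
Qed.

Lemma singly_generated_id h : singly_generated h h.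
Proof. by move=> S [_ /(_ h erefl)]. Qed.

Lemma singly_generated_lin h u v (a c : R) : singly_generated h u ->
  singly_generated h v -> singly_generated h (fun x => a * u x + c * v x).
Proof.
move=> hu hv S SS; have [[[_ _ SZ SD _] _] _] := SS.
exact: (SD _ _ (SZ a _ (hu _ SS)) (SZ c _ (hv _ SS))).1.
Qed.

Lemma singly_generated_min h u (b : R) : 0 <= b -> singly_generated h u ->
  singly_generated h (fun x => Num.min (u x) b).
Proof.
move=> b0 hu S SS; have [[SA _] _] := SS.
exact: closed_subalgebra_min (hu _ SS).
Qed.

End closed_subalgebras.

(** * C_0, C_c and Urysohn functions *)

Section function_spaces.
Context {R : realType} {X : topologicalType}.
Implicit Types (u v f g r : X -> R) (A D K U : set X) (B : set (X -> R)).

Lemma continuous_minr u (b : R) : continuous u ->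
  continuous (fun x => Num.min (u x) b).
Proof.
move=> cu; apply: (@min_fun_continuous _ _ _ u (cst b)) => // x.
exact: cvg_cst.
Qed.

Lemma continuous_lin u v (a c : R) : continuous u -> continuous v ->
  continuous (fun x => a * u x + c * v x).
Proof.
move=> cu cv x; apply: cvgD; apply: cvgM; try exact: cvg_cst.
  exact: cu.
exact: cv.
Qed.

Lemma closed_superlevel u (a : R) : continuous u -> closed [set x | a <= u x].
Proof.
move=> cu; apply: (@closed_comp _ _ u [set y | a <= y]); last exact: closed_ge.
by move=> x _; exact: cu.
Qed.

Lemma open_superlevel u (a : R) : continuous u -> open [set x | a < u x].
Proof.
move=> cu; apply: (@open_comp _ _ u [set y | a < y]); last exact: open_gt.
by move=> x _; exact: cu.
Qed.

Lemma supp_subset f D : closed D -> (forall x, f x != 0 -> D x) ->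
  supp f `<=` D.
Proof. by move=> /closure_id cD fD; rewrite [X in _ `<=` X]cD;
  exact: closureS. Qed.

Lemma supp_neq0 f x : f x != 0 -> supp f x.
Proof. by move=> fx; exact: subset_closure. Qed.

Lemma supp_eq0 f x : ~ supp f x -> f x = 0.
Proof. by move=> nfx; apply/eqP/negPn/negP => /supp_neq0. Qed.

(* Condition under which C_0 and C_c are handled simultaneously. *)
Definition intermediate_ideal B := [/\ B `<=` C_0, C_c `<=` B &
  forall f1 f2 g (k : R), B f1 -> B f2 -> continuous g ->
    (forall x, `|g x| <= k * (`|f1 x| + `|f2 x|)) -> B g].

Lemma C_c_subset_C_0 : (C_c : set (X -> R)) `<=` C_0.
Proof.
move=> f [cf sf]; split => // e e0; apply: subclosed_compact sf _.
  apply: (@closed_superlevel (fun x => `|f x|)) => x.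
  by apply: cvg_norm; exact: cf.
move=> x /= efx; apply: supp_neq0; rewrite -normr_gt0.
exact: lt_le_trans efx.
Qed.

Lemma intermediate_ideal_C_c : intermediate_ideal C_c.
Proof.
split => //; first exact: C_c_subset_C_0.
move=> f1 f2 g k [_ s1] [_ s2] cg gk; split => //.
apply: (subclosed_compact _ (compactU s1 s2)); first exact: closed_closure.
apply: supp_subset; first by apply: closedU; exact: closed_closure.
move=> x gx; have [f1x|f1x] := eqVneq (f1 x) 0; last by left; exact: supp_neq0.
right; apply: supp_neq0; apply: contra_neq gx => f2x.
by have := gk x; rewrite f1x f2x normr0 addr0 mulr0 normr_le0 => /eqP.
Qed.

Lemma intermediate_ideal_C_0 : intermediate_ideal C_0.
Proof.
split => //; first exact: C_c_subset_C_0.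
move=> f1 f2 g k [_ s1] [_ s2] cg gk; split => // e e0.
pose d := e / (2 * (`|k| + 1)).
have k0 : 0 < 2 * (`|k| + 1) by have := normr_ge0 k; lra.
have d0 : 0 < d by rewrite divr_gt0.
apply: (subclosed_compact _ (compactU (s1 _ d0) (s2 _ d0))).
  by apply: (@closed_superlevel (fun x => `|g x|)) => x; apply: cvg_norm;
    exact: cg.
move=> x /= egx; have [f1d|f1d] := leP d `|f1 x|; first by left.
have [f2d|f2d] := leP d `|f2 x|; first by right.
have := le_trans egx (gk x); rewrite leNgt => /negP; case.
apply: le_lt_trans (_ : (`|k| + 1) * (`|f1 x| + `|f2 x|) < _).
  by apply: ler_wpM2r; [exact: addr_ge0|have := ler_norm k; lra].
have : `|f1 x| + `|f2 x| < d * 2 by lra.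
have -> : e = (`|k| + 1) * (d * 2) by rewrite /d; field; have := normr_ge0 k;
  lra.
by rewrite ltr_pM2l//; have := normr_ge0 k; lra.
Qed.

(** The one-point compactification is compact Hausdorff, hence normal, and Urysohn's lemma applies
    there to [K] and the complement of [U], which contains the point at infinity. Having [g = 1] on
    a whole neighbourhood [N] of [K] later keeps the supports of differences [k - g] away from
    [K]. *)
Lemma locally_compact_urysohn K U : hausdorff_space X ->
  locally_compact [set: X] -> compact K -> open U -> K `<=` U ->
  exists g N, [/\ C_c g, forall x, 0 <= g x <= 1, supp g `<=` U,
    open N /\ K `<=` N & forall x, N x -> g x = 1 :> R].
Proof.
move=> hX lX cK oU KU; pose opc := one_point_compactification X.
have hopc : hausdorff_space opc := one_point_compactification_hausdorff lX hX.
have nopc : normal_space opc.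
  exact: (compact_normal hopc one_point_compactification_compact).
have cSK : closed (Some @` K : set opc).
  apply: compact_closed hopc _; apply: continuous_compact cK.
  exact/continuous_subspaceT/one_point_compactification_some_continuous.
have cSU : closed (~` (Some @` U) : set opc).
  exact/open_closedC/one_point_compactification_open_some.
have KU0 : (Some @` K : set opc) `&` ~` (Some @` U) = set0.
  by rewrite -subset0 => _ [[x Kx <-]]; apply; exists x => //; exact: KU.
have /(uniform_separatorP (R:=R))[f [cf f01 f0 f1]] :=
  (normal_separatorP (R:=R)).1 nopc _ _ cSK cSU KU0.
pose k x := 1 - f (Some x).
have ck : continuous k.
  move=> x; apply: cvgB; first exact: cvg_cst.
  apply: (@continuous_comp X opc R Some f); last exact: cf.
  exact: one_point_compactification_some_continuous.
have k01 x : 0 <= k x <= 1.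
  have : [set` `[0, 1]] (f (Some x)) by apply: f01; exists (Some x).
  by rewrite /k /= in_itv/=; lra.
(* [f] is 1 at infinity, so [f > 1/2], that is [k < 1/2], off some compact set. *)
have cC : compact [set x | 1/2 <= k x].
  have : nbhs (f None) [set y | 1/2 < y].
    have -> : f None = 1 by apply: f1; exists None => // -[].
    by apply: open_nbhs_nbhs; split; [exact: open_gt|rewrite /=; lra].
  move=> /(cf None)[W [cW clW] WN]; apply: subclosed_compact cW _.
    exact: closed_superlevel.
  move=> x /=; apply: contraPP => nWx.
  have : f (Some x) > 1/2 by apply: WN; left; exists x.
  by rewrite /k; lra.
have cu : continuous (fun x => 4 * k x - 2).
  move=> x; apply: cvgB; last exact: cvg_cst.
  by apply: cvgM; [exact: cvg_cst|exact: ck].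
(* [u] runs from 0 at [k = 1/2] to 1 at [k = 3/4]. Clipped to [0, 1] it is supported in the compact
   set [{k >= 1/2}] and equals 1 on the open set [{k > 3/4}]. *)
pose u x := 4 * k x - 2.
pose g x := Num.min (u x - Num.min (u x) 0) 1.
have cg : continuous g.
  apply: continuous_minr => x; apply: cvgB; first exact: cu.
  exact: (@continuous_minr u 0).
have gC x : g x != 0 -> 1/2 <= k x.
  apply: contra_neqT; rewrite -ltNge => kx.
  have ux : u x <= 0 by rewrite /u; lra.
  by rewrite /g (min_l ux) subrr min_l.
have sg : supp g `<=` [set x | 1/2 <= k x].
  by apply: supp_subset gC; exact: closed_superlevel.
exists g, [set x | 3/4 < k x]; split.
- by split=> //; apply: (subclosed_compact _ cC sg); exact: closed_closure.
- move=> x; rewrite /g; case: (leP (u x) 0) => ux.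
    by rewrite subrr min_l// lexx ler01.
  by rewrite subr0 le_min ge_min lexx orbT (ltW ux) ler01.
- move=> x /sg /=; apply: contraPP => nUx; rewrite /k.
  have -> : f (Some x) = 1 by apply: f1; exists (Some x) => // -[y Uy [yx]];
    rewrite yx in Uy.
  by lra.
- split; first exact: open_superlevel.
  move=> x Kx; rewrite /= /k.
  have -> : f (Some x) = 0 by apply: f0; exists (Some x) => //; exists x.
  by lra.
- move=> x /= kx; have u0 : 0 <= u x by rewrite /u; lra.
  by rewrite /g (min_r u0) subr0 min_r// /u; lra.
Qed.

End function_spaces.

(** * Quasi-linear functionals *)

Section quasi_linear_functionals.
Context {R : realType} {X : topologicalType} {B : set (X -> R)}
  (iB : intermediate_ideal B) {rho : (X -> R) -> R} (qB : quasi_linear B rho).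
Implicit Types (u v f g h r : X -> R).

Lemma ideal_continuous u : B u -> continuous u.
Proof. by case: iB => BC0 _ _ /BC0[]. Qed.

Lemma ideal_lin u v (a c : R) : B u -> B v -> B (fun x => a * u x + c * v x).
Proof.
move=> Bu Bv; have [_ _ iBd] := iB.
apply: (iBd u v _ (`|a| + `|c|)) => // [|x].
  by apply: continuous_lin; exact: ideal_continuous.
rewrite (le_trans (ler_normD _ _))// !normrM.
have := normr_ge0 (u x); have := normr_ge0 (v x).
by have := normr_ge0 a; have := normr_ge0 c; nra.
Qed.

Lemma ideal_scale u (a : R) : B u -> B (fun x => a * u x).
Proof.
move=> Bu; have -> : (fun x => a * u x) = (fun x => a * u x + 0 * u x).
  by apply/funext => x; rewrite mul0r addr0.
exact: ideal_lin.
Qed.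

Lemma ideal_add u v : B u -> B v -> B (fun x => u x + v x).
Proof.
move=> Bu Bv; have -> : (fun x => u x + v x) = (fun x => 1 * u x + 1 * v x).
  by apply/funext => x; rewrite !mul1r.
exact: ideal_lin.
Qed.

Lemma ideal_sub u v : B u -> B v -> B (fun x => u x - v x).
Proof.
move=> Bu Bv; have -> : (fun x => u x - v x) = (fun x => 1 * u x + -1 * v x).
  by apply/funext => x; rewrite mul1r mulN1r.
exact: ideal_lin.
Qed.

Lemma ideal_min u (b : R) : 0 <= b -> B u -> B (fun x => Num.min (u x) b).
Proof.
move=> b0 Bu; have [_ _ iBd] := iB; apply: (iBd u u _ 1) => // [|x].
  by apply: continuous_minr; exact: ideal_continuous.
rewrite mul1r; case: (leP (u x) b) => ub; first by rewrite ler_wpDl.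
rewrite ger0_norm// (le_trans (ltW ub))// (le_trans (ler_norm _))//.
by rewrite ler_wpDl.
Qed.

Lemma ql_lin h u v (a c : R) : B h -> B u -> B v ->
  singly_generated h u -> singly_generated h v ->
  rho (fun x => a * u x + c * v x) = a * rho u + c * rho v.
Proof.
move=> Bh Bu Bv hu hv; have [qZ qD _] := qB.
have sg w (k : R) : singly_generated h w -> singly_generated h (k *: w).
  by move=> hw S SS; have [[[_ _ SZ _ _] _] _] := SS; exact: SZ (hw _ SS).
rewrite -!qZ// -(qD (a *: u) (c *: v) h)//; try exact: sg.
  exact: ideal_scale.
exact: ideal_scale.
Qed.

Lemma ql_le h u v : B h -> B u -> B v -> singly_generated h u ->
  singly_generated h v -> (forall x, u x <= v x) -> rho u <= rho v.
Proof.
move=> Bh Bu Bv hu hv uv; have [_ _ q0] := qB.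
rewrite -subr_ge0 -[rho v]mul1r -mulN1r -(@ql_lin h)//.
by apply: q0 => [|x]; [exact: ideal_lin|rewrite mul1r mulN1r subr_ge0].
Qed.

Lemma qlZ f (a : R) : B f -> rho (fun x => a * f x) = a * rho f.
Proof. by case: qB => + _ _; exact. Qed.

Lemma ql_min_le u (b : R) : 0 <= b -> B u -> rho (fun x => Num.min (u x) b) <=
  rho u.
Proof.
move=> b0 Bu; apply: (@ql_le u) => //; first exact: ideal_min.
- by apply: singly_generated_min => //; exact: singly_generated_id.
- exact: singly_generated_id.
- by move=> x; rewrite ge_min lexx.
Qed.

Lemma ql_min_sub u (b c d e : R) : 0 <= b -> 0 <= c -> B u ->
  rho (fun x => d * Num.min (u x) b + e * Num.min (u x) c) =
  d * rho (fun x => Num.min (u x) b) + e * rho (fun x => Num.min (u x) c).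
Proof.
move=> b0 c0 Bu; apply: (@ql_lin u) => //; try exact: ideal_min.
  by apply: singly_generated_min => //; exact: singly_generated_id.
by apply: singly_generated_min => //; exact: singly_generated_id.
Qed.

(* Both f and r belong to the algebra generated by f + r, as
   r = min (f + r, 1). *)
Lemma ql_nested f r : B f -> B r -> (forall x, 0 <= f x) ->
  (forall x, r x <= 1) -> (forall x, f x != 0 -> r x = 1) ->
  rho (fun x => r x - f x) = rho r - rho f.
Proof.
move=> Bf Br f0 r1 fr; pose h x := 1 * f x + 1 * r x.
have Bh : B h by exact: ideal_lin.
have rE : r = fun x => Num.min (h x) 1.
  apply/funext => x; rewrite /h !mul1r; have [->|fx] := eqVneq (f x) 0.
    by rewrite add0r min_l.
  by rewrite fr// min_r// lerDr.
have hr : singly_generated h r.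
  by rewrite rE; apply: singly_generated_min => //; exact: singly_generated_id.
have fE : f = fun x => 1 * h x + -1 * r x.
  by apply/funext => x; rewrite /h; lra.
have hf : singly_generated h f.
  by rewrite fE; apply: singly_generated_lin => //; exact: singly_generated_id.
have -> : (fun x => r x - f x) = (fun x => 1 * r x + -1 * f x).
  by apply/funext => x; lra.
by rewrite (@ql_lin h)//; lra.
Qed.

(** Substitute for monotonicity: from [f <= r] alone no common generator is in sight. *)
Lemma ql_nested_le f r : B f -> B r -> (forall x, 0 <= f x <= 1) ->
  (forall x, 0 <= r x <= 1) -> (forall x, f x != 0 -> r x = 1) ->
  rho f <= rho r.
Proof.
move=> Bf Br f01 r01 fr; rewrite -subr_ge0 -ql_nested//.
- have [_ _ q0] := qB; apply: q0 => [|x].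
    exact: ideal_sub.
  have [->|fx] := eqVneq (f x) 0; first by rewrite subr0; case/andP: (r01 x).
  by rewrite fr// subr_ge0; case/andP: (f01 x).
- by move=> x; case/andP: (f01 x).
- by move=> x; case/andP: (r01 x).
Qed.

(* Both f and g belong to the algebra generated by f - g. *)
Lemma ql_orthogonal f g : B f -> B g -> (forall x, 0 <= f x) ->
  (forall x, 0 <= g x) -> (forall x, f x = 0 \/ g x = 0) ->
  rho (fun x => f x + g x) = rho f + rho g.
Proof.
move=> Bf Bg f0 g0 fg; pose h x := 1 * f x + -1 * g x.
have Bh : B h by exact: ideal_lin.
pose m x := Num.min (h x) 0.
have hm : singly_generated h m.
  by apply: singly_generated_min => //; exact: singly_generated_id.
have mE x : m x = - g x.
  rewrite /m /h; case: (fg x) => ->;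
    first by rewrite mulr0 add0r mulN1r min_l// oppr_le0.
  by rewrite mulr0 addr0 mul1r min_r// oppr0.
have gE : g = fun x => -1 * m x + 0 * m x.
  by apply/funext => x; rewrite mE; lra.
have hg : singly_generated h g.
  by rewrite gE; exact: singly_generated_lin.
have fE : f = fun x => 1 * h x + 1 * g x.
  by apply/funext => x; rewrite /h; lra.
have hf : singly_generated h f.
  by rewrite fE; apply: singly_generated_lin => //; exact: singly_generated_id.
have -> : (fun x => f x + g x) = (fun x => 1 * f x + 1 * g x).
  by apply/funext => x; lra.
by rewrite (@ql_lin h)//; lra.
Qed.

End quasi_linear_functionals.

(** * The topological measure of a quasi-linear functional *)

Section mu_of_theory.
Context {R : realType} {X : topologicalType}.
Implicit Types (f : X -> R) (rho : (X -> R) -> R) (A U V : set X).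
Local Open Scope ereal_scope.

Lemma mu_open_ge rho f U : C_c f -> (forall x, 0 <= f x <= 1)%R ->
  supp f `<=` U -> (rho f)%:E <= mu_open rho U.
Proof. by move=> cf f01 fU; apply: ereal_sup_ubound; exists f. Qed.

Lemma mu_open_le rho U V : U `<=` V -> mu_open rho U <= mu_open rho V.
Proof.
move=> UV; apply: ereal_sup_le => _ [f [cf f01 fU] <-]; exists f => //.
by split => //; exact: subset_trans UV.
Qed.

Lemma mu_of_openE rho U : open U -> mu_of rho U = mu_open rho U.
Proof. by move=> oU; rewrite /mu_of asboolT. Qed.

(** Removes the case distinction in [mu_of], so that it can be treated as an outer set function on
    all subsets. *)
Lemma mu_of_inf rho A : mu_of rho A =
  ereal_inf [set mu_open rho U | U in [set U | open U /\ A `<=` U]].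
Proof.
rewrite /mu_of; case: asboolP => // oA; apply/eqP; rewrite eq_le.
apply/andP; split; last by apply: ereal_inf_lbound; exists A; split.
by apply: le_ereal_inf_tmp => _ [U [_ AU] <-]; exact: mu_open_le.
Qed.

Lemma mu_of_le rho A A' : A `<=` A' -> mu_of rho A <= mu_of rho A'.
Proof.
move=> AA'; rewrite !mu_of_inf; apply: ereal_inf_le_tmp => _ [U [oU A'U] <-].
by exists U => //; split => //; exact: subset_trans A'U.
Qed.

Lemma mu_of_le_open rho A U : open U -> A `<=` U ->
  mu_of rho A <= mu_open rho U.
Proof. by move=> oU AU; rewrite -mu_of_openE//; exact: mu_of_le. Qed.

Lemma mu_of_supp rho f A : C_c f -> (forall x, 0 <= f x <= 1)%R ->
  supp f `<=` A -> (rho f)%:E <= mu_of rho A.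
Proof.
move=> cf f01 fA; rewrite mu_of_inf; apply: le_ereal_inf_tmp => _ [U [_ AU] <-].
by apply: mu_open_ge => //; exact: subset_trans AU.
Qed.

End mu_of_theory.

Section topological_measure_mu_of.
Context {R : realType} {X : topologicalType} (hX : hausdorff_space X)
  (lX : locally_compact [set: X]) {B : set (X -> R)}
  (iB : intermediate_ideal B) {rho : (X -> R) -> R} (qB : quasi_linear B rho).
Implicit Types (f g h k r : X -> R) (A K U V W : set X).
Local Open Scope ereal_scope.

Let lam := mu_open rho.
Let mu := mu_of rho.

Let CcB f : C_c f -> B f.
Proof. by case: iB => _ + _; exact. Qed.

Let iCc := @intermediate_ideal_C_c R X.

Let disjointP A A' : A `&` A' = set0 -> forall x, A x -> A' x -> False.
Proof. by move=> AA' x Ax A'x; have : (A `&` A') x by []; rewrite AA'. Qed.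

Lemma C_c_compact f K : continuous f -> compact K ->
  (forall x, f x != 0%R -> K x) -> C_c f.
Proof.
move=> cf cK fK; split => //; apply: (subclosed_compact _ cK).
  exact: closed_closure.
by apply: supp_subset => //; exact: compact_closed.
Qed.

Lemma C_c0 : C_c (cst 0%R : X -> R).
Proof.
apply: (@C_c_compact _ set0) => [x||x]; first exact: cvg_cst.
  exact: compact0.
by rewrite eqxx.
Qed.

Lemma supp0 : supp (cst 0%R : X -> R) = set0.
Proof.
rewrite -subset0; apply: supp_subset => [|x]; first exact: closed0.
by rewrite eqxx.
Qed.

Lemma supp_add f g : supp (fun x => f x + g x)%R `<=` supp f `|` supp g.
Proof.
apply: supp_subset => [|x fgx]; first by apply: closedU; exact: closed_closure.
have [fx|fx] := eqVneq (f x) 0%R; last by left; exact: supp_neq0.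
by right; apply: supp_neq0; apply: contra_neq fgx => ->; rewrite fx addr0.
Qed.

Lemma continuous_at_local f g O x : open O -> O x ->
  (forall y, O y -> f y = g y) -> {for x, continuous g} ->
  {for x, continuous f}.
Proof.
move=> oO Ox fg cg; rewrite /prop_for /continuous_at fg//.
apply: cvg_trans cg; apply: near_eq_cvg.
have : nbhs x O by exact: open_nbhs_nbhs.
by apply: filterS => y /fg.
Qed.

Lemma ql0 : rho (cst 0%R) = 0%R.
Proof.
rewrite -[RHS](mul0r (rho (cst 0%R))) -(qlZ qB); last exact/CcB/C_c0.
by congr rho; apply/funext => x; rewrite mul0r.
Qed.

Lemma mu_open_ge0 U : 0 <= lam U.
Proof.
rewrite /lam -[0]/(0%R%:E) -ql0; apply: mu_open_ge; first exact: C_c0.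
  by move=> x; rewrite lexx ler01.
by rewrite supp0.
Qed.

Lemma mu_of_ge0 A : 0 <= mu A.
Proof.
rewrite /mu mu_of_inf; apply: le_ereal_inf_tmp => _ [U _ <-].
exact: mu_open_ge0.
Qed.

(** Lets the open neighbourhoods in the infimum be treated one at a time inside a sum. The value
    [y = +oo] is split off because it cannot be moved to the other side. *)
Lemma le_mu_of_add A (y z : \bar R) : 0 <= y ->
  (forall W, open W -> A `<=` W -> z <= lam W + y) -> z <= mu A + y.
Proof.
move=> y0 h; have [->|yoo] := eqVneq y +oo.
  by rewrite addey ?leey// gt_eqF// (lt_le_trans ltNy0)// mu_of_ge0.
rewrite -leeBlDr; last by rewrite ge0_fin_numE// ltey.
rewrite /mu mu_of_inf; apply: le_ereal_inf_tmp => _ [W [oW AW] <-].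
by rewrite leeBlDr ?h// ge0_fin_numE// ltey.
Qed.

Lemma mu_open_add_le U (y z : \bar R) : 0 <= y ->
  (forall f, C_c f -> (forall x, 0 <= f x <= 1)%R -> supp f `<=` U ->
    (rho f)%:E + y <= z) -> lam U + y <= z.
Proof.
move=> y0 h; have [yoo|yoo] := eqVneq y +oo.
  suff -> : z = +oo by rewrite leey.
  apply/eqP; rewrite -leye_eq; have := h _ C_c0; rewrite yoo addey//; apply.
    by move=> x; rewrite lexx ler01.
  by rewrite supp0.
rewrite -leeBrDr; last by rewrite ge0_fin_numE// ltey.
apply: ge_ereal_sup => _ [f [cf f01 fU] <-].
by rewrite leeBrDr ?h// ge0_fin_numE// ltey.
Qed.

(** For [s > 1] the open set [{r > 1/s}] contains [K]. A test function [f] supported there is nested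
    in [min (s r, 1)], which is 1 on that set, so [rho f <= s * rho r]. Then [s] tends to 1. *)
Lemma mu_of_le_rho r K : B r -> (forall x, 0 <= r x)%R ->
  (forall x, K x -> 1 <= r x)%R -> mu K <= (rho r)%:E.
Proof.
move=> Br r0 Kr; have rho0 : (0 <= rho r)%R by case: qB => _ _; apply.
have key (s : R) : (1 < s)%R -> mu K <= (s * rho r)%:E.
  move=> s1; have s0 : (0 < s)%R by rewrite (lt_trans ltr01).
  have oU : open [set x | s^-1 < r x]%R.
    by apply: open_superlevel; exact: (ideal_continuous iB).
  have KU : K `<=` [set x | s^-1 < r x]%R.
    by move=> x /Kr /=; apply: lt_le_trans; rewrite invf_lt1.
  apply: le_trans (mu_of_le_open rho oU KU) _.
  apply: ge_ereal_sup => _ [f [cf f01 fU] <-]; rewrite lee_fin.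
  have Bs : B (fun x => s * r x)%R by exact: (ideal_scale iB).
  rewrite -(qlZ qB)//; apply: le_trans (ql_min_le iB qB ler01 Bs).
  apply: (ql_nested_le iB qB) => //; first exact: CcB.
  - exact: (ideal_min iB).
  - by move=> x; rewrite le_min ge_min lexx orbT ler01 !andbT mulr_ge0// ltW.
  - move=> x /supp_neq0/fU/= /ltW sr; rewrite min_r//.
    by rewrite -(divff (x:=s)) ?gt_eqF// ler_pM2l.
apply/lee_addgt0Pr => e e0.
(* [s = 1 + e / (rho r + 1)] costs at most [e]; the [+ 1] covers [rho r = 0]. *)
have d0 : (0 < e / (rho r + 1))%R by rewrite divr_gt0// ltr_wpDl.
apply: le_trans (key (1 + e / (rho r + 1))%R _) _; first by rewrite ltrDl.
rewrite -EFinD lee_fin mulrDl mul1r lerD2l mulrAC ler_pdivrMr ?ltr_wpDl//.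
by rewrite ler_wpM2l ?(ltW e0)// lerDl.
Qed.

Lemma mu_of_compact_finite : compact_finite_tm mu.
Proof.
move=> K cK; have [g [N [cg g01 _ [_ KN] gN]]] :=
  locally_compact_urysohn (R := R) hX lX cK openT (@subsetT _ K).
apply: le_lt_trans (mu_of_le_rho (CcB cg) _ _) (ltry _) => x.
  by case/andP: (g01 x).
by move=> /KN/gN ->.
Qed.

Lemma mu_of_openD U V : open U -> open V -> U `&` V = set0 ->
  mu (U `|` V) = mu U + mu V.
Proof.
move=> oU oV /disjointP UV.
have oUV := openU oU oV; rewrite /mu !mu_of_openE// -/lam.
apply/eqP; rewrite eq_le; apply/andP; split.
  apply: ge_ereal_sup => _ [h [ch h01 hUV] <-].
  (* Cutting [h] off outside one of the two open sets keeps it continuous: the nonzero values stay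
     in [supp h] minus the other set, which is closed and contained in the first. *)
  pose cut (C : set X) x := if `[< C x >] then h x else 0%R.
  have cutP (C D : set X) : open C -> open D -> (forall x, C x -> D x ->
    False) ->
      supp h `<=` C `|` D ->
      [/\ C_c (cut C), (forall x, 0 <= cut C x <= 1)%R & supp (cut C) `<=` C].
    move=> oC oD CD hCD; have cf : continuous (cut C).
      move=> x; have [Cx|nCx] := pselect (C x).
        apply: (@continuous_at_local _ h C) => // [y Cy|].
          by rewrite /cut asboolT.
        by case: ch => + _; exact.
      apply: (@continuous_at_local _ (fun=> 0%R) (D `|` ~` supp h)).
      - by apply: openU => //; apply: closed_openC; exact: closed_closure.
      - by have [/hCD[//|]|] := pselect (supp h x); [left|right].
      - move=> y; rewrite /cut; case: asboolP => // Cy [Dy|/supp_eq0//].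
        by have := CD _ Cy Dy.
      - exact: cvg_cst.
    have fh x : cut C x != 0%R -> C x /\ supp h x.
      rewrite /cut; case: asboolP => [Cx hx|_]; last by rewrite eqxx.
      by split => //; exact: supp_neq0.
    split.
    - by case: ch => _ sh; apply: (C_c_compact cf sh) => x /fh[].
    - by move=> x; rewrite /cut; case: ifP => // _; rewrite lexx ler01.
    - have : supp (cut C) `<=` supp h `&` ~` D.
        apply: supp_subset => [|x /fh[Cx hx]]; last by split => // /(CD _ Cx).
        by apply: closedI; [exact: closed_closure|exact: open_closedC].
      by move=> sf x /sf[/hCD[]].
  have [cf f01 fU] := cutP U V oU oV UV hUV.
  have VU x : V x -> U x -> False by move=> Vx /UV; exact.
  rewrite setUC in hUV; have [cg g01 gV] := cutP V U oV oU VU hUV.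
  have -> : h = fun x => (cut U x + cut V x)%R.
    apply/funext => x; rewrite /cut; case: asboolP => [Ux|nUx].
      by rewrite asboolF ?addr0// => /(UV _ Ux).
    case: asboolP => [Vx|nVx]; rewrite add0r//; apply: supp_eq0.
    by move=> /hUV[].
  rewrite (ql_orthogonal iB qB) //; try exact: CcB.
  - by rewrite EFinD leeD//; exact: mu_open_ge.
  - by move=> x; case/andP: (f01 x).
  - by move=> x; case/andP: (g01 x).
  - move=> x; rewrite /cut; case: asboolP => [Ux|nUx]; last by left.
    by right; rewrite asboolF// => /(UV _ Ux).
apply: mu_open_add_le => [|f cf f01 fU]; first exact: mu_open_ge0.
rewrite addeC; apply: mu_open_add_le => [|g cg g01 gV].
  by rewrite lee_fin; case: qB => _ _; apply => [|x];
    [exact: CcB|case/andP: (f01 x)].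
have fg x : f x = 0%R \/ g x = 0%R.
  have [Ux|nUx] := pselect (U x); [right|left]; apply: supp_eq0.
    by move=> /gV /(UV _ Ux).
  by move=> /fU.
rewrite -EFinD addrC -(ql_orthogonal iB qB)//; try exact: CcB.
- apply: mu_open_ge.
  + exact: (ideal_add iCc).
  + by move=> x; case: (fg x) => ->; rewrite ?add0r ?addr0.
  + exact: subset_trans (@supp_add f g) (setUSS fU gV).
- by move=> x; case/andP: (f01 x).
- by move=> x; case/andP: (g01 x).
Qed.

(** A Urysohn function separates [K] and [L] by disjoint open sets. Intersecting arbitrary
    neighbourhoods with these reduces both inequalities to [mu_of_openD]. *)
Lemma mu_of_compactD K L : compact K -> compact L -> K `&` L = set0 ->
  mu (K `|` L) = mu K + mu L.
Proof.
move=> cK cL /disjointP KL0.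
have KL : K `<=` ~` L by move=> x Kx /(KL0 _ Kx).
have oL : open (~` L) by apply: closed_openC; exact: compact_closed.
have [g [N [[cg _] _ gL [_ KN] gN]]] := locally_compact_urysohn (R := R) hX lX
  cK oL KL.
pose U := [set x | 1 / 2 < g x]%R; pose V := ~` supp g.
have oU : open U by exact: open_superlevel.
have oV : open V by apply: closed_openC; exact: closed_closure.
have KU : K `<=` U by move=> x /KN /gN gx; rewrite /U /= gx; lra.
have LV : L `<=` V by move=> x Lx /gL.
have UV0 : U `&` V = set0.
  rewrite -subset0 => x [Ux]; apply; apply: supp_neq0; rewrite gt_eqF//.
  by apply: lt_trans Ux; lra.
have UVD (U' V' : set X) : open U' -> open V' ->
    mu ((U `&` U') `|` (V `&` V')) = mu (U `&` U') + mu (V `&` V').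
  move=> oU' oV'; apply: mu_of_openD; [exact: openI|exact: openI|].
  by rewrite setIACA UV0 set0I.
apply/eqP; rewrite eq_le; apply/andP; split.
  apply: le_mu_of_add => [|U' oU' KU']; first exact: mu_of_ge0.
  rewrite addeC; apply: le_mu_of_add => [|V' oV' LV']; first exact: mu_open_ge0.
  apply: (@le_trans _ _ (mu ((U `&` U') `|` (V `&` V')))).
    apply: mu_of_le; apply: setUSS; rewrite subsetI; split.
    - exact: KU.
    - exact: KU'.
    - exact: LV.
    - exact: LV'.
  by rewrite UVD// addeC leeD// mu_of_le_open//; exact: subIsetr.
rewrite /mu [leRHS]mu_of_inf; apply: le_ereal_inf_tmp => _ [W [oW KLW] <-].
apply: (@le_trans _ _ (mu ((U `&` W) `|` (V `&` W)))).
  rewrite UVD//; apply: leeD; apply: mu_of_le; rewrite subsetI; split => //.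
    by move=> x Kx; apply: KLW; left.
  by move=> x Lx; apply: KLW; right.
by apply: mu_of_le_open => //; rewrite -setIUl; exact: subIsetr.
Qed.

Lemma mu_of_compact_openD_open K U : compact K -> open U -> K `&` U = set0 ->
  open (K `|` U) -> mu (K `|` U) = mu K + mu U.
Proof.
move=> cK oU /disjointP KU oKU.
apply/eqP; rewrite eq_le; apply/andP; split.
  rewrite /mu [leLHS]mu_of_openE//;
    apply: ge_ereal_sup => _ [h [ch h01 hKU] <-].
  apply: le_mu_of_add => [|W oW KW]; first exact: mu_of_ge0.
  have KWI : K `<=` W `&` (K `|` U) by move=> x Kx; split; [exact: KW|left].
  have [g [N [cg g01 gW [oN KN] gN]]] :=
    locally_compact_urysohn (R := R) hX lX cK (openI oW oKU) KWI.
  have cS : compact (supp h `|` supp g).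
    by apply: compactU; [case: ch|case: cg].
  have SU : supp h `|` supp g `<=` K `|` U by move=> x [/hKU//|/gW[]].
  (* [h] and [g] have no evident common generator, so [h - g] is of no use. Both are nested in [k],
     which gives [rho h <= rho k = rho g + rho (k - g)]. Here [g] lives in [W], and [k - g] lives
     off [N], hence in [U]. *)
  have [k [M [ck k01 kU [_ SM] kM]]] := locally_compact_urysohn (R := R) hX lX
    cS oKU SU.
  have hk x : h x != 0%R -> k x = 1%R.
    by move=> /supp_neq0 hx; apply/kM/SM; left.
  have gk x : g x != 0%R -> k x = 1%R.
    by move=> /supp_neq0 hx; apply/kM/SM; right.
  have hk_le : (rho h <= rho k)%R.
    by apply: (ql_nested_le iB qB) => //; exact: CcB.
  apply: (@le_trans _ _ (rho k)%:E) => //.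
  have g0 x : (0 <= g x)%R by case/andP: (g01 x).
  have k1 x : (k x <= 1)%R by case/andP: (k01 x).
  have kgE := ql_nested iB qB (CcB cg) (CcB ck) g0 k1 gk.
  have -> : (rho k)%:E = (rho g)%:E + (rho (fun x => k x - g x)%R)%:E.
    by rewrite -EFinD kgE addrC subrK.
  apply: leeD.
    by apply: mu_open_ge => // x /gW[].
  rewrite mu_of_openE//; apply: mu_open_ge.
  - exact: (ideal_sub iCc).
  - move=> x; have := g01 x; have := k01 x.
    by have [->|/gk ->] := eqVneq (g x) 0%R; lra.
  - have : supp (fun x => k x - g x)%R `<=` supp k `&` ~` N.
      apply: supp_subset => [|x kgx].
        by apply: closedI; [exact: closed_closure|exact: open_closedC].
      have gx1 : ~ N x.
        by move=> /gN gx; move: kgx; rewrite gk gx ?subrr ?eqxx ?oner_eq0.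
      split => //; apply: supp_neq0; apply: contra_neq kgx => kx.
      have [->|/gk] := eqVneq (g x) 0%R; first by rewrite kx subr0.
      by rewrite kx => /esym/eqP; rewrite oner_eq0.
    by move=> s x /s[/kU[/KN|//]].
rewrite [leLHS]addeC /mu (mu_of_openE _ oU) (mu_of_openE _ oKU).
apply: mu_open_add_le => [|f cf f01 fU]; first exact: mu_of_ge0.
(* Keeping [g] away from [supp f] makes [f] and [g] orthogonal, and [f + g] competes for the open
   set [K |_| U]. *)
have oW : open ((K `|` U) `&` ~` supp f).
  by apply: openI => //; apply: closed_openC; exact: closed_closure.
have KW : K `<=` (K `|` U) `&` ~` supp f.
  by move=> x Kx; split; [left|move=> /fU /(KU _ Kx)].
have [g [N [cg g01 gW [oN KN] gN]]] := locally_compact_urysohn (R := R) hX lX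
  cK oW KW.
have g0 x : (0 <= g x)%R by case/andP: (g01 x).
apply: (@le_trans _ _ ((rho f)%:E + (rho g)%:E)).
  apply: leeD => //; apply: mu_of_le_rho => [||x /KN/gN->//]; last exact: g0.
  exact: CcB.
have fg x : f x = 0%R \/ g x = 0%R.
  have [fx|nfx] := pselect (supp f x); [right|left]; apply: supp_eq0 => //.
  by move=> /gW[].
rewrite -EFinD -(ql_orthogonal iB qB)//; try exact: CcB.
- apply: mu_open_ge.
  + exact: (ideal_add iCc).
  + by move=> x; case: (fg x) => ->; rewrite ?add0r ?addr0.
  + by move=> x /supp_add[/fU|/gW[]//]; right.
- by move=> x; case/andP: (f01 x).
Qed.

Lemma mu_of_compact_openD_compact K U : compact K -> open U ->
  K `&` U = set0 -> compact (K `|` U) -> mu (K `|` U) = mu K + mu U.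
Proof.
move=> cK oU /disjointP KU cKU.
have clKU : closed (K `|` U) by exact: compact_closed.
apply/eqP; rewrite eq_le; apply/andP; split; last first.
  rewrite [leLHS]addeC /mu (mu_of_openE _ oU).
  apply: mu_open_add_le => [|f cf f01 fU]; first exact: mu_of_ge0.
  apply: (@le_trans _ _ (mu (supp f) + mu K)).
    by apply: leeD => //; exact: mu_of_supp.
  rewrite -mu_of_compactD//; last 2 first.
  - by case: cf.
  - by rewrite -subset0 => x [/fU Ux /KU]; exact.
  by apply: mu_of_le => x [/fU|]; [right|left].
apply: le_mu_of_add => [|W oW KW]; first exact: mu_of_ge0.
have [g [N [cg g01 gW [oN KN] gN]]] := locally_compact_urysohn (R := R) hX lX
  cK oW KW.
(* [k] is continuous because it equals 1 on the open set [N] union [U] and equals [g] off the closed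
   set [K] union [U]. The difference [f = k - g] is nested in [k] and supported in [U]. *)
pose k x := if `[< (K `|` U) x >] then 1%R else g x.
have k1 x : (K `|` U) x -> k x = 1%R by move=> KUx; rewrite /k asboolT.
have kg x : k x != g x -> (K `|` U) x.
  by rewrite /k; case: asboolP => //; rewrite eqxx.
have ck : continuous k.
  move=> x; have [KUx|nKUx] := pselect ((K `|` U) x); last first.
    apply: (@continuous_at_local _ g (~` (K `|` U))) => //.
    - exact: closed_openC.
    - by move=> y; rewrite /k => ?; rewrite asboolF.
    - by case: cg => + _; exact.
  apply: (@continuous_at_local _ (fun=> 1%R) (N `|` U)).
  - exact: openU.
  - by case: KUx => [/KN|]; [left|right].
  - move=> y [/gN gy|Uy]; last by apply: k1; right.
    by rewrite /k; case: ifP.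
  - exact: cvg_cst.
have k01 x : (0 <= k x <= 1)%R by rewrite /k; case: ifP => // _;
  rewrite ler01 lexx.
have Ck : C_c k.
  apply: (@C_c_compact _ (K `|` U `|` supp g)) => //.
    by apply: compactU => //; case: cg.
  move=> x; rewrite /k; case: asboolP => [|_ /supp_neq0]; first by left.
  by right.
pose f x := (k x - g x)%R.
have Cf : C_c f by exact: (ideal_sub iCc).
have f0 x : (0 <= f x)%R.
  by have := g01 x; rewrite /f /k; case: ifP => _; lra.
have f1 x : (f x <= 1)%R by have := g01 x; have := k01 x; rewrite /f; lra.
have sf : supp f `<=` (K `|` U) `&` ~` N.
  apply: supp_subset => [|x]; first by apply: closedI => //;
    exact: open_closedC.
  rewrite /f subr_eq0 => fx; split; first exact: kg.
  by move=> /gN gx; move: (fx); rewrite gx k1 ?eqxx//; exact: kg.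
have kle1 x : (k x <= 1)%R by case/andP: (k01 x).
have fk x : f x != 0%R -> k x = 1%R by rewrite subr_eq0 => /kg/k1.
have kfE := ql_nested iB qB (CcB Cf) (CcB Ck) f0 kle1 fk.
apply: (@le_trans _ _ (rho k)%:E).
  apply: mu_of_le_rho => [||x /k1 ->//]; first exact: CcB.
  by move=> x; case/andP: (k01 x).
have gE : (fun x => k x - f x)%R = g by apply/funext => x; rewrite /f; lra.
have -> : (rho k)%:E = (rho g)%:E + (rho f)%:E.
  by rewrite -EFinD -gE kfE subrK.
apply: leeD; first exact: mu_open_ge.
rewrite /mu mu_of_openE//; apply: mu_open_ge => // x.
  by rewrite f0 f1.
by move=> /sf[[/KN|//]].
Qed.

Lemma topological_measure_mu_of : topological_measure mu.
Proof.
split.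
- by move=> A _; exact: mu_of_ge0.
- exists set0; first by left; exact: open0.
  rewrite lt_eqF//; apply: mu_of_compact_finite; exact: compact0.
- move=> A A' AA'0 [cA|oA] [cA'|oA'] cAA'.
  + exact: mu_of_compactD.
  + case: cAA'; first exact: mu_of_compact_openD_compact.
    exact: mu_of_compact_openD_open.
  + rewrite setUC addeC in cAA' *; rewrite setIC in AA'0.
    case: cAA'; first exact: mu_of_compact_openD_compact.
    exact: mu_of_compact_openD_open.
  + exact: mu_of_openD.
- move=> U oU; apply/eqP; rewrite eq_le; apply/andP; split.
    (* The supports of the test functions are the compact sets that exhaust [mu U]. *)
    rewrite {1}/mu mu_of_openE//; apply: ge_ereal_sup => _ [f [cf f01 fU] <-].
    apply: le_trans (mu_of_supp rho cf f01 (@subset_refl _ _)) _.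
    by apply: ereal_sup_ubound; exists (supp f) => //; case: cf.
  by apply: ge_ereal_sup => _ [K [_ KU] <-]; exact: mu_of_le.
- move=> F _; rewrite {1}/mu mu_of_inf; congr ereal_inf.
  by apply/seteqP; split => _ [U [oU FU] <-]; exists U => //;
    rewrite /mu mu_of_openE.
Qed.

(** Cutting at height [d] leaves [r - min (r, d)], supported in the compact set [{r >= d}] and so
    admissible for [{r > 0}]. The rest is [d] times a function with values in [0, 1] that vanishes
    where [r] does, so it contributes at most [C d]. *)
Lemma rho_le_mu_open r :
  (exists C : R, forall w, B w -> (forall x, 0 <= w x <= 1)%R ->
    (forall x, w x != 0 -> r x != 0)%R -> (rho w <= C)%R) ->
  B r -> (forall x, 0 <= r x <= 1)%R ->
  (rho r)%:E <= lam [set x | 0 < r x]%R.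
Proof.
move=> [C hC] Br r01.
have C0 : (0 <= C)%R.
  apply: le_trans (hC _ (CcB C_c0) _ _); first by rewrite ql0.
    by move=> x; rewrite lexx ler01.
  by move=> x; rewrite eqxx.
have key (d : R) : (0 < d)%R -> (d < 1)%R -> (rho r)%:E <= lam [set x | 0 < r
  x]%R + (C * d)%:E.
  move=> d0 d1; pose m x := Num.min (r x) d.
  have Bm : B m by apply: (ideal_min iB) => //; exact: ltW.
  have r1E : (fun x => Num.min (r x) 1%R) = r.
    by apply/funext => x; rewrite min_l//; case/andP: (r01 x).
  have E := ql_min_sub iB qB 1%R (-1)%R ler01 (ltW d0) Br.
  rewrite r1E -/m mul1r mulN1r in E.
  have -> : rho r = (rho (fun x => 1 * Num.min (r x) 1 + -1 * m x) + rho m)%R.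
    by rewrite E subrK.
  rewrite EFinD; apply: leeD.
    have Bcf : B (fun x => 1 * Num.min (r x) 1 + -1 * m x)%R.
      by apply: (ideal_lin iB) => //; rewrite r1E.
    have rm x : (1 * Num.min (r x) 1 + -1 * m x != 0 -> d <= `|r x|)%R.
      move=> h; have /andP[rx0 rx1] := r01 x; rewrite ger0_norm// leNgt.
      apply: contraNN h => rd; rewrite /m min_l// (min_l (ltW rd)).
      by rewrite mul1r mulN1r subrr.
    have cr : compact [set x | d <= `|r x|]%R by case: iB => /(_ _ Br)[_ +] _
      _; exact.
    apply: mu_open_ge.
    - by apply: C_c_compact cr rm; exact: (ideal_continuous iB).
    - move=> x; have /andP[rx0 rx1] := r01 x; rewrite /m (min_l rx1).
      by case: (leP (r x) d) => ?; lra.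
    - have clr : closed [set x | d <= `|r x|]%R by exact: compact_closed.
      move=> x /(supp_subset clr rm)/=; have /andP[rx0 _] := r01 x.
      by rewrite ger0_norm//; exact: lt_le_trans.
  rewrite lee_fin -ler_pdivrMr// mulrC -(qlZ qB)//; apply: hC.
  - exact: (ideal_scale iB).
  - move=> x; have /andP[rx0 _] := r01 x.
    rewrite mulr_ge0 ?invr_ge0 ?(ltW d0)//= ?le_min ?rx0 ?(ltW d0)//.
    by rewrite ler_pdivrMl// mulr1 ge_min lexx orbT.
  - move=> x; apply: contra_neq => rx; rewrite /m rx min_l ?mulr0//.
    exact: ltW.
apply/lee_addgt0Pr => e e0.
have d0 : (0 < Num.min (1/2) (e / (C + 1)))%R.
  by rewrite lt_min divr_gt0//= divr_gt0// ltr_wpDl.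
apply: le_trans (key _ d0 _) _; first by rewrite gt_min; apply/orP; left; lra.
apply: leeD => //; rewrite lee_fin.
apply: (@le_trans _ _ (C * (e / (C + 1)))%R).
  by rewrite ler_wpM2l// ge_min lexx orbT.
rewrite mulrA ler_pdivrMr ?ltr_wpDl// mulrC ler_wpM2l ?(ltW e0)//.
by rewrite lerDl.
Qed.

End topological_measure_mu_of.

(** * Truncated and Stieltjes integrals *)

Section truncated_integrals.
Context {R : realType}.

(* d has zero derivative in the averaged sense: the oscillation bound
   telescopes over a uniform partition. *)
Lemma eq_of_monotone_modulus (d H : R -> R) (M : R) : 0 < M ->
  (forall a b, 0 <= a -> a < b -> `|d b - d a| <= (b - a) * (H a - H b)) ->
  d M = d 0.
Proof.
move=> M0 dH.
have key (n : nat) : `|d M - d 0| * n.+1%:R <= M * (H 0 - H M).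
  pose e := M / n.+1%:R; have e0 : 0 < e by rewrite divr_gt0.
  have step k : `|d (e * k%:R) - d 0| <= e * (H 0 - H (e * k%:R)).
    elim: k => [|k IH]; first by rewrite mulr0 !subrr normr0 mulr0.
    rewrite -(subrKA (d (e * k%:R))) (le_trans (ler_normD _ _))//.
    have -> : e * (H 0 - H (e * k.+1%:R)) =
      e * (H (e * k%:R) - H (e * k.+1%:R)) + e * (H 0 - H (e * k%:R)) by ring.
    apply: lerD => //.
    have ekk : e * k%:R < e * k.+1%:R by rewrite ltr_pM2l// ltr_nat.
    have ek0 : 0 <= e * k%:R by rewrite mulr_ge0// ltW.
    have := dH _ _ ek0 ekk.
    by rewrite -mulrBr -natrB// subSnn mulr1.
  have := step n.+1; rewrite /e divfK// => h.
  by rewrite -ler_pdivlMr// mulrAC.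
apply/eqP; rewrite -subr_eq0 -normr_le0 leNgt; apply/negP => d0.
pose n := Num.truncn (M * (H 0 - H M) / `|d M - d 0|).
have : M * (H 0 - H M) < `|d M - d 0| * n.+1%:R.
  by rewrite [ltRHS]mulrC -ltr_pdivrMr// truncnS_gt.
by rewrite ltNge key.
Qed.

Context {d : measure_display} {T : measurableType d}
  (m : {measure set T -> \bar R}).
Local Open Scope ereal_scope.

(** Pointwise, [min (u, b) - min (u, a)] lies between [b - a] times the indicators of [{b <= u}] and
    [{a < u}]. The increment [J] is added rather than obtained by subtraction because the integrals
    may be infinite. *)
Lemma integral_truncation_bounds (u : T -> R) (a b : R) :
  measurable_fun setT u -> (forall x, 0 <= u x)%R -> (0 <= a)%R -> (a < b)%R ->
  exists J, [/\ \int[m]_x (Num.min (u x) b)%:E =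
                  \int[m]_x (Num.min (u x) a)%:E + J,
    (b - a)%:E * m [set x | b <= u x]%R <= J &
    J <= (b - a)%:E * m [set x | a < u x]%R].
Proof.
move=> mu u0 a0 ab; have ba0 : (0 <= b - a)%R by rewrite subr_ge0 ltW.
have mmin (c : R) : measurable_fun setT (fun x => Num.min (u x) c).
  by apply: measurable_minr => //; exact: measurable_cst.
have mdiff : measurable_fun setT (fun x => Num.min (u x) b - Num.min (u x) a)%R.
  exact: measurable_funB.
have min_le x : (Num.min (u x) a <= Num.min (u x) b)%R.
  by rewrite le_min ge_min lexx/= ge_min (ltW ab) orbT.
have mge (c : R) : measurable [set x | c <= u x]%R.
  rewrite -[X in measurable X]setTI;
    have -> : [set x | c <= u x]%R = u @^-1` `[c, +oo[.
    by apply/seteqP; split=> x /=; rewrite in_itv/= andbT.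
  by apply: mu => //; exact: measurable_itv.
have mgt (c : R) : measurable [set x | c < u x]%R.
  rewrite -[X in measurable X]setTI;
    have -> : [set x | c < u x]%R = u @^-1` `]c, +oo[.
    by apply/seteqP; split=> x /=; rewrite in_itv/= andbT.
  by apply: mu => //; exact: measurable_itv.
have indE (A : set T) : measurable A ->
    (b - a)%:E * m A = \int[m]_x ((b - a) * \1_A x)%:E.
  move=> mA; under eq_integral do rewrite EFinM.
  rewrite ge0_integralZl//.
  - by rewrite integral_indic// setIT.
  - by apply/measurable_EFinP; exact: measurable_indic.
have mind (A : set T) : measurable A ->
    measurable_fun setT (fun x => ((b - a) * \1_A x)%:E).
  move=> mA; apply/measurable_EFinP; exact: measurable_funM.
exists (\int[m]_x (Num.min (u x) b - Num.min (u x) a)%:E); split.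
- rewrite -ge0_integralD//.
  + by apply: eq_integral => x _; rewrite -EFinD addrC subrK.
  + by move=> x _; rewrite lee_fin le_min u0 a0.
  + exact/measurable_EFinP.
  + by move=> x _; rewrite lee_fin subr_ge0.
  + exact/measurable_EFinP.
- rewrite indE//; apply: ge0_le_integral => //.
  + by move=> x _; rewrite lee_fin mulr_ge0// indicE.
  + exact: mind.
  + exact/measurable_EFinP.
  + move=> x _; rewrite lee_fin indicE; have [bu|ub] := leP b (u x).
      by rewrite mem_set// mulr1 !min_r// (le_trans (ltW ab)).
    rewrite memNset/=; last by rewrite leNgt ub.
    by rewrite mulr0 subr_ge0 ge_min lexx.
- rewrite indE//; apply: ge0_le_integral => //.
  + by move=> x _; rewrite lee_fin subr_ge0.
  + exact/measurable_EFinP.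
  + exact: mind.
  + move=> x _; rewrite lee_fin indicE; have [au|ua] := ltP a (u x).
      by rewrite mem_set// mulr1 lerD2r ge_min lexx orbT.
    rewrite memNset/=; last by rewrite ltNge ua.
    by rewrite mulr0 subr_le0 ge_min lexx.
Qed.

(** The real-valued [H] forces every increment, hence every truncated integral, to be finite; this
    allows a real-valued [q]. Truncating at [M] changes [u] only on a null set. *)
Lemma integral_truncation (u : T -> R) (H : R -> R) :
  measurable_fun setT u -> (forall x, 0 <= u x)%R ->
  (forall a, (0 <= a)%R -> m [set x | a < u x]%R <= (H a)%:E) ->
  (forall b, (0 < b)%R -> (H b)%:E <= m [set x | b <= u x]%R) ->
  exists q : R -> R, [/\ q 0%R = 0%R,
    (forall a b, 0 <= a -> a < b ->
      (b - a) * H b <= q b - q a <= (b - a) * H a)%R &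
    forall M, (0 < M)%R -> m [set x | M < u x]%R = 0 ->
      \int[m]_x (u x)%:E = (q M)%:E].
Proof.
move=> mu u0 mH Hm.
pose I b := \int[m]_x (Num.min (u x) b)%:E.
have I0 : I 0%R = 0.
  by rewrite /I integral0_eq// => x _; rewrite min_r.
have IJ a b : (0 <= a)%R -> (a < b)%R -> exists j : R,
    I b = I a + j%:E /\ ((b - a) * H b <= j <= (b - a) * H a)%R.
  move=> a0 ab; have b0 : (0 < b)%R by exact: le_lt_trans ab.
  have ba0 : 0 <= (b - a)%:E by rewrite lee_fin subr_ge0 ltW.
  have [J [IJ Jge Jle]] := integral_truncation_bounds mu u0 a0 ab.
  have {}Jge : ((b - a) * H b)%:E <= J.
    by apply: le_trans Jge; rewrite EFinM; apply: lee_wpmul2l => //; exact: Hm.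
  have {}Jle : J <= ((b - a) * H a)%:E.
    by apply: le_trans Jle _; rewrite EFinM; apply: lee_wpmul2l => //;
      exact: mH.
  have Jfin : J \is a fin_num.
    by rewrite fin_numE; apply/andP; split; apply/eqP => JE;
      [move: Jge|move: Jle]; rewrite JE.
  exists (fine J); rewrite fineK//; split => //.
  by rewrite -!lee_fin fineK// Jge Jle.
have Ifin b : (0 <= b)%R -> I b \is a fin_num.
  rewrite le_eqVlt => /predU1P[<-|b0]; first by rewrite I0.
  by have [j [-> _]] := IJ 0%R b (lexx _) b0; rewrite I0 add0e.
exists (fine \o I); split; first by rewrite /= I0.
  move=> a b a0 ab; have [j [/= -> jH]] := IJ a b a0 ab.
  by rewrite fineD ?Ifin//= [(fine (I a) + _)%R]addrC addrK.
move=> M M0 muM; rewrite /= fineK ?Ifin ?ltW//; apply: ge0_ae_eq_integral => //.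
- exact/measurable_EFinP.
- by apply/measurable_EFinP; apply: measurable_minr => //;
    exact: measurable_cst.
- by move=> x _; rewrite lee_fin.
- by move=> x _; rewrite lee_fin le_min u0 ltW.
- have mM : measurable [set x | M < u x]%R.
    rewrite -[X in measurable X]setTI.
    have -> : [set x | M < u x]%R = u @^-1` `]M, +oo[.
      by apply/seteqP; split=> x /=; rewrite in_itv/= andbT.
    by apply: mu => //; exact: measurable_itv.
  exists [set x | M < u x]%R; split => // x /=; apply: contra_notP.
  by move=> /negP; rewrite -leNgt => uM _; rewrite min_l.
Qed.

Lemma integral_eq_of_truncation_bounds (u : T -> R) (p H : R -> R) (M : R) :
  measurable_fun setT u -> (forall x, 0 <= u x)%R -> (0 < M)%R ->
  m [set x | M < u x]%R = 0 ->
  (forall a, (0 <= a)%R -> m [set x | a < u x]%R <= (H a)%:E) ->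
  (forall b, (0 < b)%R -> (H b)%:E <= m [set x | b <= u x]%R) ->
  p 0%R = 0%R ->
  (forall a b, 0 <= a -> a < b ->
    (b - a) * H b <= p b - p a <= (b - a) * H a)%R ->
  \int[m]_x (u x)%:E = (p M)%:E.
Proof.
move=> mu u0 M0 muM mH Hm p0 pH.
have [q [q0 qH qM]] := integral_truncation mu u0 mH Hm.
rewrite (qM M)//.
congr EFin; apply/eqP; rewrite -subr_eq0; apply/eqP.
transitivity (q 0%R - p 0%R)%R; last by rewrite q0 p0 subrr.
apply: (@eq_of_monotone_modulus (fun t => q t - p t)%R H) => // a b a0 ab.
have /andP[? ?] := qH a b a0 ab; have /andP[? ?] := pH a b a0 ab.
by rewrite ler_norml; apply/andP; split; lra.
Qed.

End truncated_integrals.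

Section stieltjes_integral.
Context {R : realType} (m : {measure set (measurableTypeR R) -> \bar R})
  (F : R -> R) (c M : R) (M0 : 0 < M)
  (mF : forall s t, s < t -> m `]s, t]%classic = (F s - F t)%:E)
  (F0 : forall a, M <= a -> F a = 0) (Fc : forall a, a <= - M -> F a = c).
Local Open Scope ereal_scope.

Let mU (A B : set (measurableTypeR R)) : measurable A -> measurable B ->
  A `&` B = set0 -> m (A `|` B) = m A + m B.
Proof. exact: measureU. Qed.

Lemma measure_itvoy a : m `]a, +oo[%classic = (F a)%:E.
Proof.
pose b := (Num.max a M + 1)%R.
have ab : (a < b)%R by rewrite /b (le_lt_trans (_ : _ <= Num.max a M)%R)
  ?ltrDl// le_max lexx.
have Mb : (M <= b)%R by rewrite /b (le_trans (_ : _ <= Num.max a M)%R)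
  ?lerDl// le_max lexx orbT.
have mb : m `]b, +oo[%classic = 0.
  apply: measure_negligible; first exact: measurable_itv.
  (* The first piece []b, b + 0]] is empty and is treated apart, as [mF] requires distinct
     endpoints. *)
  rewrite itv_bndy_bigcup_BRight; apply: negligible_bigcup => -[|k].
    by rewrite addr0 set_itvoc0; exact: negligible_set0.
  apply/negligibleP; first exact: measurable_itv.
  by rewrite [LHS]mF ?ltrDl// !F0 ?subrr// (le_trans Mb)// lerDl ler0n.
have -> : `]a, +oo[%classic = `]a, b]%classic `|` `]b, +oo[%classic :> set R.
  apply/seteqP; split => x /=; rewrite !in_itv/= ?andbT.
    by move=> ax; case: (leP x b) => xb; [left; rewrite ax|right].
  by move=> [/andP[]//|]; exact: lt_trans.
rewrite mU; [|exact: measurable_itv|exact: measurable_itv|].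
  by rewrite mb adde0 mF// (F0 Mb) subr0.
rewrite -subset0 => x /=; rewrite !in_itv/= andbT => -[/andP[_ xb] bx].
by move: xb; rewrite leNgt bx.
Qed.

Lemma measure_itvNyc a : m `]-oo, a]%classic = (c - F a)%:E.
Proof.
pose b := (Num.min a (- M) - 1)%R.
have ba : (b < a)%R by rewrite /b (@lt_le_trans _ _ (Num.min a (- M)))%R//
  ?ltrBlDr ?ltrDl// ge_min lexx.
have bM : (b <= - M)%R by rewrite /b (@le_trans _ _ (Num.min a (- M)))%R//
  ?lerBlDr ?lerDl// ge_min lexx orbT.
have mb : m `]-oo, b]%classic = 0.
  apply: measure_negligible; first exact: measurable_itv.
  rewrite itvNy_bnd_bigcup_BLeft; apply: negligible_bigcup => k.
  (* The pieces [[b - k, b]] are closed on the left; lowering the endpoint by 1 puts them inside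
     half-open intervals covered by [mF]. *)
  exists `](b - k%:R - 1)%R, b]%classic; split.
  - exact: measurable_itv.
  - have bk : (b - k%:R - 1 < b)%R by rewrite -addrA -opprD ltrBlDr ltrDl
      ltr_wpDl.
    by rewrite mF// !Fc ?subrr// (le_trans (ltW bk)).
  - move=> x /=; rewrite !in_itv/= => /andP[bx ->]; rewrite andbT.
    by rewrite (lt_le_trans _ bx)// ltrBlDr ltrDl.
have -> : `]-oo, a]%classic = `]-oo, b]%classic `|` `]b, a]%classic :> set R.
  apply/seteqP; split => x /=; rewrite !in_itv/=.
    by move=> xa; case: (leP x b) => xb; [left|right].
  by move=> [xb|/andP[]//]; rewrite (le_trans xb)// ltW.
rewrite mU; [|exact: measurable_itv|exact: measurable_itv|].
  by rewrite mb add0e mF// (Fc bM).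
rewrite -subset0 => x /=; rewrite !in_itv/= => -[xb /andP[bx _]].
by move: xb; rewrite leNgt bx.
Qed.

Lemma measure_pos_gt a : (0 <= a)%R ->
  m [set t | a < Num.max t 0]%R = (F a)%:E.
Proof.
move=> a0; rewrite -measure_itvoy; congr (m _).
by apply/seteqP; split => t /=;
  rewrite in_itv/= andbT lt_max (ltNge a 0%R) a0 orbF.
Qed.

Lemma measure_pos_ge b : (0 < b)%R ->
  (F b)%:E <= m [set t | b <= Num.max t 0]%R.
Proof.
move=> b0; rewrite -measure_itvoy; apply: le_measure; rewrite ?inE.
- exact: measurable_itv.
- have -> : [set t | b <= Num.max t 0]%R = `[b, +oo[%classic.
    by apply/seteqP; split => t /=;
      rewrite in_itv/= andbT le_max (leNgt b 0%R) b0 orbF.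
  exact: measurable_itv.
- by move=> t /=; rewrite in_itv/= andbT le_max => /ltW ->.
Qed.

Lemma measurable_pos :
  measurable_fun setT (fun t : measurableTypeR R => Num.max (t : R) 0%R).
Proof.
by apply: measurable_maxr => [_ Y mY|]; [rewrite setTI|exact: measurable_cst].
Qed.

(** The positive part of the identity has tail [F]. For the negative part the tail comes from []-oo,
    -a]], of mass [c - F (- a)]. An atom at [-a] separates the strict from the weak tail, so at [a]
    this value is an upper bound for the strict tail and exact for the weak one. *)
Lemma integral_stieltjes (p n : R -> R) : p 0%R = 0%R -> n 0%R = 0%R ->
  (forall a b, 0 <= a -> a < b ->
    (b - a) * F b <= p b - p a <= (b - a) * F a)%R ->
  (forall a b, 0 <= a -> a < b ->
    (b - a) * (c - F (- b)) <= n b - n a <= (b - a) * (c - F (- a)))%R ->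
  \int[m]_t t%:E = (p M - n M)%:E.
Proof.
move=> p0 n0 pF nF.
have mid : measurable_fun setT (fun t : measurableTypeR R => t : R).
  by move=> _ Y mY; rewrite setTI.
rewrite integralE EFinB; congr (_ - _).
  rewrite -(@integral_eq_of_truncation_bounds _ _ _ m
    (fun t : measurableTypeR R => Num.max (t : R) 0%R) p F M)//.
  - by apply: eq_integral => t _; rewrite funeposE EFin_max.
  - exact: measurable_pos.
  - by move=> t; rewrite le_max lexx orbT.
  - by rewrite measure_pos_gt ?F0// ltW.
  - by move=> a a0; rewrite measure_pos_gt.
  - exact: measure_pos_ge.
rewrite -(@integral_eq_of_truncation_bounds _ _ _ m
  (fun t : measurableTypeR R => Num.max (- (t : R)) 0)%R n
  (fun a => c - F (- a))%R M)//.
- by apply: eq_integral => t _; rewrite funenegE EFin_max EFinN.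
- apply: measurable_maxr; last exact: measurable_cst.
  exact: measurable_funN.
- by move=> t; rewrite le_max lexx orbT.
- apply/eqP; rewrite -measure_le0.
  have <- : m `]-oo, (- M)%R]%classic = 0 by rewrite measure_itvNyc Fc ?subrr.
  apply: le_measure; rewrite ?inE.
  + have -> : [set t | M < Num.max (- t) 0]%R = `]-oo, (- M)%R[%classic.
      apply/seteqP; split => t /=;
        rewrite in_itv/= lt_max [(M < 0)%R]ltNge (ltW M0) orbF ltrNr//.
    exact: measurable_itv.
  + exact: measurable_itv.
  + by move=> t /=;
      rewrite in_itv/= lt_max [(M < 0)%R]ltNge (ltW M0) orbF ltrNr => /ltW.
- move=> a a0; rewrite -measure_itvNyc; apply: le_measure; rewrite ?inE.
  + have -> : [set t | a < Num.max (- t) 0]%R = `]-oo, (- a)%R[%classic.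
      by apply/seteqP; split => t /=;
        rewrite in_itv/= lt_max [(a < 0)%R]ltNge a0 orbF ltrNr.
    exact: measurable_itv.
  + exact: measurable_itv.
  + by move=> t /=;
      rewrite in_itv/= lt_max [(a < 0)%R]ltNge a0 orbF ltrNr => /ltW.
- move=> b b0; rewrite -measure_itvNyc.
  have -> : [set t | b <= Num.max (- t) 0]%R = `]-oo, (- b)%R]%classic.
    by apply/seteqP; split => t /=;
      rewrite in_itv/= le_max [(b <= 0)%R]leNgt b0 orbF lerNr.
  by [].
Qed.

(* For F vanishing from 1 on and constant on negative numbers: the Stieltjes
   measure lives on [0, 1]. *)
Lemma integral_stieltjes01 : M = 1%R -> (F 0 <= c)%R ->
  (forall a, a < 0 -> F a = c)%R -> exists v : R,
  [/\ \int[m]_t t%:E = v%:E, (v <= F 0)%R &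
      (forall s, 0 < s -> s < 1 -> s * F s <= v)%R].
Proof.
move=> M1 F0c Fneg.
have u0 (t : measurableTypeR R) : (0 <= Num.max (t : R) 0)%R.
  by rewrite le_max lexx orbT.
have mle a : (0 <= a)%R -> m [set t | a < Num.max t 0]%R <= (F a)%:E.
  by move=> a0; rewrite measure_pos_gt.
have [q [q0 qF _]] := integral_truncation measurable_pos u0 mle measure_pos_ge.
exists (q 1%R); split.
- rewrite (@integral_stieltjes q (fun=> 0%R))//; first by rewrite M1 subr0.
  move=> a b a0 ab; rewrite subrr (Fneg (- b)%R); last first.
    by rewrite oppr_lt0 (le_lt_trans a0).
  rewrite subrr mulr0 lexx/=; apply: mulr_ge0; first by rewrite subr_ge0 ltW.
  (* At [a = 0] the mass [c - F 0] of the point 0 may be positive, but it enters only an upper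
     bound. *)
  rewrite subr_ge0; move: a0; rewrite le_eqVlt => /predU1P[<-|a0].
    by rewrite oppr0.
  by rewrite Fneg// oppr_lt0.
- by have := qF 0%R 1%R (lexx _) ltr01; rewrite q0 !subr0 !mul1r => /andP[].
- move=> s s0 s1; have /andP[h1 _] := qF 0%R s (lexx _) s0.
  have /andP[h2 _] := qF s 1%R (ltW s0) s1.
  have F1 : F 1%R = 0%R by rewrite F0// M1.
  by move: h1 h2; rewrite q0 F1; lra.
Qed.

End stieltjes_integral.

(** * Representation and uniqueness *)

Section stieltjes_measures.
Context {R : realType}.
Local Open Scope ereal_scope.

Lemma stieltjes_measure (F : R -> \bar R) : decumulative F ->
  exists2 m : {measure set (measurableTypeR R) -> \bar R}, stieltjes F = m &
    forall s t, (s < t)%R -> m `]s, t]%classic = (fine (F s) - fine (F t))%:E.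
Proof.
move=> dF; have [m mE] : exists m : {measure set (measurableTypeR R) -> \bar R},
    stieltjes F = m.
  rewrite /stieltjes; case: pselect => // dF'.
  by exists (lebesgue_stieltjes_measure (cumulative_of dF')).
exists m => // s t st; rewrite -mE stieltjesE//; case: dF => fF _ _.
by rewrite EFinB !fineK.
Qed.

End stieltjes_measures.

Section tail_integrals.
Context {R : realType} {X : topologicalType}.
Implicit Types (f : X -> R) (D U K : set X) (nu : set X -> \bar R).
Local Open Scope ereal_scope.

(* Common form of tail_C0 (D the whole space) and tail_Cc (D = {f <> 0}). *)
Definition tail_on nu f D (a : R) : \bar R := nu ((f @^-1` `]a, +oo[) `&` D).

Lemma tail_C0E nu f : tail_C0 nu f = tail_on nu f setT.
Proof. by apply/funext => a; rewrite /tail_on setIT. Qed.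

Lemma tail_CcE nu f : tail_Cc nu f = tail_on nu f [set x | f x != 0%R].
Proof.
apply/funext => a; congr nu; apply/seteqP; split => x [/= fx /eqP fx0];
by split => //; exact/eqP.
Qed.

Lemma open_neq0 f : continuous f -> open [set x | f x != 0%R].
Proof.
move=> cf; apply: (@open_comp _ _ f [set y | (y != 0)%R]); last exact: open_neq.
by move=> x _; exact: cf.
Qed.

Lemma tm_set0 nu : topological_measure nu -> nu set0 < +oo -> nu set0 = 0.
Proof.
move=> [nu0 _ nuD _ _] nuoo.
have fin0 : nu set0 \is a fin_num.
  by rewrite ge0_fin_numE// nu0//; left; exact: open0.
have c0 : compact (set0 : set X) \/ open (set0 : set X).
  by left; exact: compact0.
have := nuD set0 set0 (setI0 _) c0 c0; rewrite setU0 => /(_ c0).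
by move: fin0; case: (nu set0) => // r _ [] rr; congr EFin; lra.
Qed.

Section fixed_function.
Context (nu : set X -> \bar R) (tm : topological_measure nu) (nu0 : nu set0 = 0)
  (f : X -> R) (cf : continuous f) (D : set X) (oD : open D)
  (finD : nu D < +oo).

Let oT a : open ((f @^-1` `]a, +oo[) `&` D).
Proof. by apply: openI => //; apply: open_comp => // x _; exact: cf. Qed.

Lemma decumulative_tail_on : decumulative (tail_on nu f D).
Proof.
apply: decumulative_tail => // a; apply: le_lt_trans finD.
by apply: tm_le_open => //; exact: subIsetr.
Qed.

Lemma tail_on_fin a : tail_on nu f D a \is a fin_num.
Proof. by case: decumulative_tail_on. Qed.

Lemma tail_on_ge (a : R) : (forall x, f x <= a)%R -> tail_on nu f D a = 0.
Proof.
move=> fa; rewrite /tail_on -nu0; congr nu; rewrite -subset0 => x [/=].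
by rewrite in_itv/= andbT ltNge fa.
Qed.

Lemma tail_on_lt (a : R) : (forall x, a < f x)%R -> tail_on nu f D a = nu D.
Proof.
move=> fa; rewrite /tail_on; congr nu; rewrite setIidr// => x _ /=.
by rewrite in_itv/= andbT fa.
Qed.

(** For uniqueness: the integral of a function with values in [0, 1] is tied to [nu] of its
    superlevel sets, from above at level 0 and from below as the level tends to 1. *)
Lemma tail_integral_bounds : (forall x, 0 <= f x <= 1)%R -> exists v : R,
  [/\ \int[stieltjes (tail_on nu f D)]_t t%:E = v%:E,
      v%:E <= tail_on nu f D 0%R &
      forall s : R, (0 < s)%R -> (s < 1)%R -> s%:E * tail_on nu f D s <= v%:E].
Proof.
move=> f01; have [m -> mF] := stieltjes_measure decumulative_tail_on.
pose F a := fine (tail_on nu f D a).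
have F0 a : (1 <= a)%R -> F a = 0%R.
  move=> a1; rewrite /F tail_on_ge// => x.
  by apply: le_trans a1; case/andP: (f01 x).
have Fneg a : (a < 0)%R -> F a = fine (nu D).
  move=> a0; rewrite /F tail_on_lt// => x.
  by apply: lt_le_trans a0 _; case/andP: (f01 x).
have Fc a : (a <= - 1)%R -> F a = fine (nu D).
  by move=> a1; apply: Fneg; apply: le_lt_trans a1 _; rewrite oppr_lt0.
have nuDfin : nu D \is a fin_num.
  by rewrite ge0_fin_numE//; case: tm => + _ _ _ _; apply; left.
have F0c : (F 0 <= fine (nu D))%R.
  by apply: fine_le => //; [exact: tail_on_fin|apply: tm_le_open => //;
    exact: subIsetr].
have [v [-> v0 vs]] := integral_stieltjes01 ltr01 mF F0 Fc erefl F0c Fneg.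
exists v; split => //.
  by rewrite -(fineK (tail_on_fin 0)) lee_fin.
by move=> s s0 s1; rewrite -(fineK (tail_on_fin s)) -EFinM lee_fin vs.
Qed.

End fixed_function.
End tail_integrals.

Section representation.
Context {R : realType} {X : topologicalType} (hX : hausdorff_space X)
  (lX : locally_compact [set: X]) {B : set (X -> R)}
  (iB : intermediate_ideal B) {rho : (X -> R) -> R} (qB : quasi_linear B rho).
Implicit Types (f g h k r : X -> R) (A K U V W : set X).
Local Open Scope ereal_scope.

Let mu := mu_of rho.

Let CcB f : C_c f -> B f.
Proof. by case: iB => _ + _; exact. Qed.

Let tm_mu : topological_measure mu := topological_measure_mu_of hX lX iB qB.

Let mu0 : mu set0 = 0.
Proof.
apply: tm_set0 => //; apply: (mu_of_compact_finite hX lX iB qB).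
exact: compact0.
Qed.

(** On open sets: a Urysohn function [f] for [K] inside [U] gives [s * nu K <= rho f <= mu U] for
    all [s < 1], and every test function for [U] satisfies [rho f <= nu {f > 0} <= nu U]. Closed
    sets follow by outer regularity. *)
Lemma mu_of_unique (nu : set X -> \bar R) (D : (X -> R) -> set X) :
  topological_measure nu -> compact_finite_tm nu ->
  (forall f, C_c f -> [/\ open (D f), forall x, f x != 0%R -> D f x,
    nu (D f) < +oo &
    (rho f)%:E = \int[stieltjes (tail_on nu f (D f))]_t t%:E]) ->
  eq_open_closed nu mu.
Proof.
move=> tm fin nuE; have nu0 : nu set0 = 0.
  by apply: tm_set0 => //; apply: fin; exact: compact0.
have [_ _ _ tm2 tm3] := tm; have [_ _ _ _ mu3] := tm_mu.
have openE U : open U -> nu U = mu U.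
  move=> oU; apply/eqP; rewrite eq_le; apply/andP; split.
    rewrite tm2//; apply: ge_ereal_sup => _ [K [cK KU] <-].
    have [f [N [cf f01 fU [_ KN] fN]]] :=
      locally_compact_urysohn (R := R) hX lX cK oU KU.
    have [oD fD finD fE] := nuE _ cf; have [cf' _] := cf.
    have [v [vE _ vs]] := tail_integral_bounds tm nu0 cf' oD finD f01.
    rewrite vE in fE; case: fE => rE; rewrite -rE in vs => {v vE rE}.
    apply: (@le_trans _ _ (rho f)%:E); last exact: mu_of_supp.
    have nuKfin : nu K \is a fin_num.
      rewrite ge0_fin_numE; first exact: fin.
      by case: tm => + _ _ _ _; apply; right; exact: compact_closed.
    have sK (s : R) : (0 < s)%R -> (s < 1)%R -> (s * fine (nu K) <= rho f)%R.
      move=> s0 s1; rewrite -lee_fin; apply: le_trans (vs s s0 s1).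
      rewrite EFinM fineK//; apply: lee_wpmul2l; first by rewrite lee_fin ltW.
      apply: tm_le_compact_open => //.
        by apply: openI => //; apply: open_comp => // x _; exact: cf'.
      move=> x Kx; have fx := fN _ (KN _ Kx); split => /=.
        by rewrite in_itv/= andbT fx.
      by apply: fD; rewrite fx oner_eq0.
    rewrite -(fineK nuKfin) lee_fin leNgt; apply/negP => h.
    have k0 : (0 <= fine (nu K))%R.
      by rewrite fine_ge0//; case: tm => + _ _ _ _; apply; right;
        exact: compact_closed.
    have r0 : (0 <= rho f)%R.
      case: qB => _ _; apply; first exact: CcB.
      by move=> x; case/andP: (f01 x).
    have kp : (0 < fine (nu K))%R by exact: le_lt_trans h.
    (* Chosen so that [s * nu K] is the midpoint of [rho f] and [nu K], which contradicts [sK]. *)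
    pose s := ((rho f + fine (nu K)) / (2 * fine (nu K)))%R.
    have s0 : (0 < s)%R by rewrite divr_gt0// ?mulr_gt0// ltr_wpDl.
    have s1 : (s < 1)%R by rewrite ltr_pdivrMr ?mulr_gt0//; lra.
    have := sK s s0 s1;
      have -> : (s * fine (nu K) = (rho f + fine (nu K)) / 2)%R.
      by rewrite /s; field; rewrite gt_eqF.
    by lra.
  rewrite /mu mu_of_openE//; apply: ge_ereal_sup => _ [f [cf f01 fU] <-].
  have [oD fD finD fE] := nuE _ cf; have [cf' _] := cf.
  have [v [vE v0 _]] := tail_integral_bounds tm nu0 cf' oD finD f01.
  rewrite fE vE; apply: le_trans v0 _; apply: tm_le_open => //.
    by apply: openI => //; apply: open_comp => // x _; exact: cf'.
  move=> x [/=]; rewrite in_itv/= andbT => fx _; apply/fU/supp_neq0.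
  by rewrite gt_eqF.
move=> A [oA|cA]; first exact: openE.
rewrite tm3// mu3//; congr ereal_inf.
by apply/seteqP; split => _ [U [oU AU] <-]; exists U; rewrite ?openE.
Qed.

(** On [C_0] the norm serves as [C]; on [C_c] it is the value of [rho] at a cut-off function equal
    to 1 near [supp r]. *)
Context (locally_bounded : forall r, B r -> exists C : R, forall w, B w ->
  (forall x, 0 <= w x <= 1)%R -> (forall x, w x != 0 -> r x != 0)%R ->
  (rho w <= C)%R).

(** The witness is [rho r] for the normalized slice [r = (min (g, b) - min (g, a)) / (b - a)], which
    has values in [0, 1], is 1 on [{g >= b}] and vanishes off [{g > a}]. *)
Lemma ql_truncation_bounds g a b : B g -> (forall x, 0 <= g x)%R ->
  (0 <= a)%R -> (a < b)%R ->
  exists v : R, [/\ (rho (fun x => Num.min (g x) b) -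
      rho (fun x => Num.min (g x) a) = (b - a) * v)%R,
    mu [set x | b <= g x]%R <= v%:E & v%:E <= mu [set x | a < g x]%R].
Proof.
move=> Bg g0 a0 ab.
have b0 : (0 <= b)%R by rewrite (le_trans a0)// ltW.
have ba : (0 < b - a)%R by rewrite subr_gt0.
pose e := ((b - a)^-1)%R; have e0 : (0 < e)%R by rewrite invr_gt0.
pose r x := (e * Num.min (g x) b + (- e) * Num.min (g x) a)%R.
have Br : B r by apply: (ideal_lin iB); exact: (ideal_min iB).
have rE x : r x = (e * (Num.min (g x) b - Num.min (g x) a))%R.
  by rewrite /r mulNr -mulrBr.
have r01 x : (0 <= r x <= 1)%R.
  rewrite rE mulr_ge0 ?(ltW e0) ?subr_ge0//=; last first.
    by rewrite le_min ge_min lexx/= ge_min (ltW ab) orbT.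
  rewrite /e ler_pdivrMl// mulr1; case: (leP (g x) a) => ga.
    by rewrite min_l ?subrr ?(ltW ba)// (le_trans ga)// ltW.
  by rewrite lerD2r ge_min lexx orbT.
exists (rho r); split.
- by rewrite (ql_min_sub iB qB)// mulNr -mulrBr mulrA mulfV ?mul1r// gt_eqF.
- apply: (mu_of_le_rho iB qB) => // [x|x /= bx]; first by case/andP: (r01 x).
  by rewrite rE (min_r bx) min_r ?mulVf ?gt_eqF// (le_trans (ltW ab)).
apply: le_trans (rho_le_mu_open hX iB qB (locally_bounded Br) Br r01) _.
have og : open [set x | a < g x]%R.
  by apply: open_superlevel; exact: (ideal_continuous iB).
rewrite /mu mu_of_openE//; apply: mu_open_le => x /=; rewrite rE.
case: (ltP a (g x)) => // ga; rewrite min_l ?(le_trans ga (ltW ab))//.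
by rewrite subrr mulr0 ltxx.
Qed.

Lemma representation f D : open D -> (forall x, f x != 0%R -> D x) ->
  mu D < +oo -> B f ->
  (rho f)%:E = \int[stieltjes (tail_on mu f D)]_t t%:E.
Proof.
move=> oD fD finD Bf; have cf := ideal_continuous iB Bf.
have C0f : C_0 f by case: iB => + _ _; exact.
have [M M0 fM] : exists2 M, (0 < M)%R & (forall x, `|f x| < M)%R.
  have [_ /(_ 1%R ltr01) c1] := C0f.
  have : compact (f @` [set x | 1 <= `|f x|]%R).
    apply: continuous_compact c1; exact: continuous_subspaceT.
  move=> /compact_bounded[M [_ /(_ (`|M| + 1)%R) hM]].
  exists (`|M| + 2)%R => [|x]; first by have := normr_ge0 M; lra.
  have [fx|fx] := leP 1%R `|f x|%R; last by have := normr_ge0 M; lra.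
  have : (`|f x| <= `|M| + 1)%R.
    by apply: hM; [have := ler_norm M; lra|exists x].
  by lra.
(* The negative and positive parts are written as linear combinations of truncations, so that both
   visibly lie in the algebra generated by [f]. *)
pose fn x := (- 1 * Num.min (f x) 0 + 0 * Num.min (f x) 0)%R.
pose fp x := (1 * f x + 1 * fn x)%R.
have Bfn : B fn by apply: (ideal_lin iB); exact: (ideal_min iB).
have Bfp : B fp by exact: (ideal_lin iB).
have sfn : singly_generated f fn.
  apply: singly_generated_lin; apply: singly_generated_min => //;
    exact: singly_generated_id.
have sfp : singly_generated f fp.
  by apply: singly_generated_lin => //; exact: singly_generated_id.
have fE : f = fun x => (1 * fp x + -1 * fn x)%R.
  by apply/funext => x; rewrite /fp; lra.
have rhoE : rho f = (rho fp - rho fn)%R.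
  by rewrite {1}fE (ql_lin iB qB _ _ Bf)//; lra.
have fnE x : fn x = Num.max (- f x)%R 0%R.
  by rewrite /fn; case: (leP (f x) 0%R) => ?; case: leP => ?; lra.
have fpE x : fp x = Num.max (f x) 0%R.
  by rewrite /fp fnE; case: leP => ?; case: leP => ?; lra.
have fn0 x : (0 <= fn x)%R by rewrite fnE le_max lexx orbT.
have fp0 x : (0 <= fp x)%R by rewrite fpE le_max lexx orbT.
have fin a := tail_on_fin tm_mu cf oD finD a.
have [m -> mF] := stieltjes_measure (decumulative_tail_on tm_mu cf oD finD).
pose F a := fine (tail_on mu f D a); pose c := fine (mu D).
have muDfin : mu D \is a fin_num.
  by rewrite ge0_fin_numE//; exact: (mu_of_ge0 hX iB qB).
have FK a : (F a)%:E = tail_on mu f D a by rewrite /F fineK.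
have F0 a : (M <= a)%R -> F a = 0%R.
  move=> Ma; rewrite /F tail_on_ge// => x.
  by rewrite (le_trans _ Ma)// (le_trans (ler_norm _))// ltW.
have Fc a : (a <= - M)%R -> F a = c.
  move=> aM; rewrite /F tail_on_lt// => x; rewrite (le_lt_trans aM)//.
  by have := fM x; rewrite ltr_norml => /andP[].
pose p t := rho (fun x => Num.min (fp x) t).
pose n t := rho (fun x => Num.min (fn x) t).
have rho0 : rho (fun=> 0%R) = 0%R := ql0 hX iB qB.
have p0 : p 0%R = 0%R.
  by rewrite /p -[RHS]rho0; congr rho; apply/funext => x; rewrite min_r.
have n0 : n 0%R = 0%R.
  by rewrite /n -[RHS]rho0; congr rho; apply/funext => x; rewrite min_r.
have oT a : open ((f @^-1` `]a, +oo[) `&` D).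
  by apply: openI => //; apply: open_comp => // x _; exact: cf.
have pF a b : (0 <= a)%R -> (a < b)%R ->
    ((b - a) * F b <= p b - p a <= (b - a) * F a)%R.
  move=> a0 ab; have [v [vE h1 h2]] := ql_truncation_bounds Bfp fp0 a0 ab.
  have ba : (0 < b - a)%R by rewrite subr_gt0.
  rewrite /p vE !ler_pM2l//.
  rewrite -!lee_fin !FK; apply/andP; split.
    apply: le_trans h1; apply: mu_of_le => x [/=]; rewrite in_itv/= andbT.
    by move=> bf _; rewrite fpE le_max (ltW bf).
  apply: le_trans h2 _; apply: mu_of_le => x /=; rewrite fpE lt_max.
  rewrite (ltNge a 0%R) a0 orbF => af; split;
    first by rewrite /= in_itv/= andbT.
  by apply: fD; rewrite gt_eqF// (le_lt_trans a0).
have nF a b : (0 <= a)%R -> (a < b)%R ->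
    ((b - a) * (c - F (- b)) <= n b - n a <= (b - a) * (c - F (- a)))%R.
  move=> a0 ab; have [v [vE h1 h2]] := ql_truncation_bounds Bfn fn0 a0 ab.
  have ba : (0 < b - a)%R by rewrite subr_gt0.
  have b0 : (0 < b)%R by exact: le_lt_trans ab.
  rewrite /n vE !ler_pM2l//.
  rewrite lerBlDr lerBrDr -!lee_fin !EFinD !FK fineK//; apply/andP; split.
    (* [D] splits into [{f <= - b}] and an open set. As [b > 0] and [f] vanishes at infinity, the
       first piece is compact, and the mixed compact-open additivity applies. *)
    apply: (@le_trans _ _ (mu ([set x | b <= fn x]%R `|` ((f @^-1` `](- b)%R,
      +oo[) `&` D)))).
      apply: mu_of_le => x Dx; case: (leP (f x) (- b)%R) => fx; [left|right].
        by rewrite /= fnE le_max lerNr fx.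
      by split => //=; rewrite in_itv/= andbT.
    have oU : open ([set x | b <= fn x]%R `|` ((f @^-1` `](- b)%R, +oo[) `&`
      D)).
      have -> : [set x | b <= fn x]%R `|` ((f @^-1` `](- b)%R, +oo[) `&` D) = D.
        apply/seteqP; split => [x [/= bx|[]//]|x Dx].
          apply: fD; apply: contraTneq bx => fx.
          by rewrite fnE fx oppr0 maxxx -ltNge.
        case: (leP (f x) (- b)%R) => fx; [left|right].
          by rewrite /= fnE le_max lerNr fx.
        by split => //=; rewrite in_itv/= andbT.
      exact: oD.
    rewrite /mu (mu_of_compact_openD_open hX lX iB qB)//.
    - by apply: leeD => //.
    - apply: (subclosed_compact _ (C0f.2 b b0)).
        by apply: closed_superlevel; exact: (ideal_continuous iB).
      move=> x /=; rewrite fnE le_max (leNgt b 0%R) b0 orbF => /le_trans; apply.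
      by rewrite -normrN ler_norm.
    - rewrite -subset0 => x [/=];
        rewrite fnE le_max (leNgt b 0%R) b0 orbF => bx [].
      by rewrite in_itv/= andbT ltrNl ltNge bx.
  (* [{f < - a}] and the part of [D] where [f > - a] are disjoint open subsets of [D]; the level set
     [{f = - a}] is lost, and an inequality suffices. *)
  apply: (@le_trans _ _ (mu [set x | a < fn x]%R + tail_on mu f D (- a))).
    by apply: leeD.
  rewrite /mu /tail_on -(mu_of_openD hX iB qB)//.
  - apply: mu_of_le => x [/=|[]//];
      rewrite fnE lt_max (ltNge a 0%R) a0 orbF => ax.
    by apply: fD; apply: contraTneq ax => ->; rewrite oppr0 -leNgt.
  - by apply: open_superlevel; exact: (ideal_continuous iB).
  - rewrite -subset0 => x [/=];
      rewrite fnE lt_max (ltNge a 0%R) a0 orbF => ax [].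
    by rewrite in_itv/= andbT ltrNl => /lt_trans /(_ ax); rewrite ltxx.
rewrite (integral_stieltjes M0 mF F0 Fc p0 n0 pF nF) rhoE.
congr (_ - _)%:E; congr rho; apply/funext => x; rewrite min_l//.
  rewrite fpE ge_max (ltW M0) andbT; exact: le_trans (ler_norm _) (ltW (fM x)).
rewrite fnE ge_max (ltW M0) andbT (le_trans (ler_norm _))// normrN.
exact: ltW.
Qed.

End representation.

Theorem theorem39 (R : realType) (X : topologicalType)
    (hausX : hausdorff_space X) (lcX : locally_compact [set: X])
    (connX : connected [set: X]) :
  (forall rho : (X -> R) -> R,
     quasi_linear C_0 rho -> (ql_norm C_0 rho < +oo)%E ->
     exists mu : set X -> \bar R,
       [/\ [/\ topological_measure mu, finite_tm mu
             & forall f, C_0 f -> (rho f)%:E = rho_C0 mu f],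
           forall nu : set X -> \bar R,
             topological_measure nu -> finite_tm nu ->
             (forall f, C_0 f -> (rho f)%:E = rho_C0 nu f) ->
             eq_open_closed nu mu,
           eq_open_closed mu (mu_of rho)
         & mu [set: X] = ql_norm C_0 rho])
  /\
  (forall rho : (X -> R) -> R,
     quasi_linear C_c rho ->
     exists mu : set X -> \bar R,
       [/\ [/\ topological_measure mu, compact_finite_tm mu
             & forall f, C_c f -> (rho f)%:E = rho_Cc mu f],
           forall nu : set X -> \bar R,
             topological_measure nu -> compact_finite_tm nu ->
             (forall f, C_c f -> (rho f)%:E = rho_Cc nu f) ->
             eq_open_closed nu mu
         & eq_open_closed mu (mu_of rho)]).
Proof.
split=> [rho qrho norm_fin|rho qrho].
- have iB := @intermediate_ideal_C_0 R X.
  have tm := topological_measure_mu_of hausX lcX iB qrho.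
  have norm_ge w : C_0 w -> (forall x, 0 <= w x <= 1) ->
      ((rho w)%:E <= ql_norm C_0 rho)%E.
    by move=> Cw w01; apply: ereal_sup_ubound; exists w.
  have norm_ge0 : (0 <= ql_norm C_0 rho)%E.
    have C0 : C_0 (cst 0 : X -> R) by apply/C_c_subset_C_0/C_c0.
    apply: le_trans (norm_ge _ C0 _); last by move=> x; rewrite lexx ler01.
    by rewrite lee_fin; case: qrho => _ _; apply.
  have norm_num : ql_norm C_0 rho \is a fin_num by rewrite ge0_fin_numE.
  have bd (r : X -> R) : C_0 r -> exists C, forall w, C_0 w ->
      (forall x, 0 <= w x <= 1) -> (forall x, w x != 0 -> r x != 0) ->
      rho w <= C.
    move=> _; exists (fine (ql_norm C_0 rho)) => w Cw w01 _.
    by rewrite -lee_fin fineK// norm_ge.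
  have muX : mu_of rho [set: X] = ql_norm C_0 rho.
    rewrite mu_of_openE; last exact: openT.
    apply/eqP; rewrite eq_le; apply/andP; split.
      apply: ge_ereal_sup => _ [f [cf f01 _] <-]; apply: norm_ge => //.
      exact: C_c_subset_C_0.
    (* The norm is a supremum over [C_0], while [mu_open] sees only [C_c]; [rho_le_mu_open] bridges
       the gap. *)
    apply: ge_ereal_sup => _ [f [cf f01] <-].
    apply: le_trans (rho_le_mu_open hausX iB qrho (bd _ cf) cf f01) _.
    exact: mu_open_le.
  have fin : finite_tm (mu_of rho) by rewrite /finite_tm muX.
  exists (mu_of rho); split => //.
    split => // f Cf; rewrite /rho_C0 tail_C0E.
    by apply: (representation hausX lcX iB qrho bd) => //; exact: openT.
  move=> nu tm_nu fin_nu nuE.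
  apply: (mu_of_unique hausX lcX iB qrho (D := fun=> setT)) => //.
    move=> K cK; apply: le_lt_trans fin_nu.
    by apply: tm_le_compact_open => //; exact: openT.
  move=> f cf; split => //; first exact: openT.
  by rewrite (nuE f (C_c_subset_C_0 cf)) /rho_C0 tail_C0E.
have iB := @intermediate_ideal_C_c R X.
have fin := mu_of_compact_finite hausX lcX iB qrho.
have tm := topological_measure_mu_of hausX lcX iB qrho.
have bd (r : X -> R) : C_c r -> exists C, forall w : X -> R, C_c w ->
    (forall x, 0 <= w x <= 1) -> (forall x, w x != 0 -> r x != 0) ->
    rho w <= C.
  move=> [_ cr]; have [g [N [cg g01 _ [_ rN] gN]]] :=
    locally_compact_urysohn (R := R) hausX lcX cr openT (@subsetT _ _).
  exists (rho g) => w cw w01 wr; apply: (ql_nested_le iB qrho) => // x wx.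
  exact/gN/rN/supp_neq0/wr.
have finD (nu : set X -> \bar R) (f : X -> R) : topological_measure nu ->
    compact_finite_tm nu -> C_c f -> (nu [set x | f x != 0%R] < +oo)%E.
  move=> tm_nu fin_nu [cf sf]; apply: le_lt_trans (fin_nu _ sf).
  apply: tm_le_open_closed => //; first exact: open_neq0.
    exact: closed_closure.
  by move=> x; exact: supp_neq0.
exists (mu_of rho); split => //.
  split => // f Cf; rewrite /rho_Cc tail_CcE.
  apply: (representation hausX lcX iB qrho bd) => //; last exact: finD.
  by case: Cf => cf _; exact: open_neq0.
move=> nu tm_nu fin_nu nuE.
apply: (mu_of_unique hausX lcX iB qrho
  (D := fun f => [set x | f x != 0])) => // f Cf; split => //.
- by case: (Cf) => cf _; exact: open_neq0.
- exact: finD.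
- by rewrite (nuE f Cf) /rho_Cc tail_CcE.
Qed.
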